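(* Let $f:\mathbb{R}^n\to\mathbb{R}$ be bounded below by $f^*$, $L_0$-Lipschitz and $L_1$-smooth, i.e. $|f(x)-f(y)|\le L_0\|x-y\|$ and $\|\nabla f(x)-\nabla f(y)\|\le L_1\|x-y\|$ for all $x,y\in\mathbb{R}^n$. Run the asynchronous residual-feedback algorithm (defined in the context) for $T$ iterations, with step size $\alpha=\frac{\sqrt{p_{\min}}}{T^{2/3}}$ and smoothing parameter $\mu=\frac{2L_0\sqrt{\bar n}}{T^{1/6}}$, and let $\tilde x$ be selected uniformly at random from the $T$ iterates $x_0,\dots,x_{T-1}$. Then $$\mathbb{E}\left[\|\nabla f(\tilde x)\|^2\right]\le \mathcal{O}\left(\bar n^{3}\,T^{-1/3}\right).$$
   Context: Setting. There are $N$ agents; the joint decision vector is $x=(x^1,\dots,x^N)\in\mathbb{R}^n$, where agent $i$ controls the block $x^i\in\mathbb{R}^{\bar n}$ (all blocks have the same dimension $\bar n$, so $n=N\bar n$). All agents use the same step size $\alpha>0$ and the same smoothing parameter $\mu>0$. Asynchrony model. $P=(p_1,\dots,p_N)$ is a fixed probability distribution with all $p_i>0$, and $p_{\min}=\min_i p_i$. At each time step $k=0,1,2,\dots$ one agent $i_k$ is selected, independently of everything before, with $\mathbb{P}(i_k=i)=p_i$. The selected agent queries the (noiseless) value of $f$ once and updates its own block; the other blocks are unchanged. Algorithm. Start at a deterministic $x_0\in\mathbb{R}^n$. At step $k$, if $i_k=i$, a vector $u_k\in\mathbb{R}^n$ is drawn, independent of the past, whose $i$-th block is $\mathcal{N}(0,I_{\bar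 n})$ and whose other blocks are zero. The gradient estimate is $$G_{\mu_i}(x_k)=\frac{f(x_k+\mu u_k)-f(x_{\ell}+\mu u_{\ell})}{\mu}\,u_k ,$$ where $\ell<k$ is the (random) most recent time step before $k$ at which agent $i$ was selected, so that $f(x_\ell+\mu u_\ell)$ is the value of agent $i$'s previous query. If agent $i$ has not been selected before step $k$ (in particular if $k=0$), the previous value is taken to be $f(x_0+\mu v_i)$, with $v_i\in\mathbb{R}^n$ an initial direction having $i$-th block $\mathcal{N}(0,I_{\bar n})$ and other blocks zero, independent of everything else. The update is $x_{k+1}=x_k-\alpha\,G_{\mu_i}(x_k)$ with $i=i_k$. The expectation is over the activation sequence, all random directions, and the choice of $\tilde x$. In $\mathcal{O}(\cdot)$ the hidden constant is independent of $T$ and $\bar n$ (it may depend on $L_0$, $L_1$, $p_{\min}$ and $f(x_0)-f^*$). *)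

(* Defs.v *)
From HB Require Import structures.
From mathcomp Require Import all_boot all_order all_algebra finmap.
From mathcomp Require Import all_classical all_reals all_analysis.

Set Implicit Arguments.
Unset Strict Implicit.
Unset Printing Implicit Defensive.

Import Order.TTheory GRing.Theory Num.Theory.
Import numFieldNormedType.Exports.

Local Open Scope classical_set_scope.
Local Open Scope ring_scope.

(* A joint decision vector x = (x^1, ..., x^N) in R^n with n = N * m is a matrix
   x : 'M[R]_(N, m), agent i's block being [row i x]. The library norm on
   matrices is the sup norm (it induces the usual topology and the usual notion
   of differentiability); the Euclidean norm is [enorm]. *)

Definition enorm (R : realType) (N m : nat) (x : 'M[R]_(N, m)) : R :=
  Num.sqrt (\sum_(i < N) \sum_(j < m) x i j ^+ 2).

Definition gradient (R : realType) (N m : nat) (f : 'M[R]_(N, m) -> R)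
    (x : 'M[R]_(N, m)) : 'M[R]_(N, m) :=
  \matrix_(i < N, j < m) 'D_(delta_mx i j) f x.

Definition elipschitz (R : realType) (N m : nat) (L : R)
    (f : 'M[R]_(N, m) -> R) : Prop :=
  forall x y, `|f x - f y| <= L * enorm (x - y).

Definition esmooth (R : realType) (N m : nat) (L : R)
    (f : 'M[R]_(N, m) -> R) : Prop :=
  (forall x, differentiable f x) /\
  (forall x y, enorm (gradient f x - gradient f y) <= L * enorm (x - y)).

Section independence.
Context {d : measure_display} {Omega : measurableType d} {R : realType}.
Variable P : probability Omega R.

Definition mutually_independent (I : choiceType) (E : I -> set (set Omega)) :
    Prop :=
  (forall i, E i `<=` measurable) /\
  (forall (J : {fset I}) (A : I -> set Omega),
    (forall i, i \in J -> E i (A i)) ->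
    P (\bigcap_(i in [set` J]) A i) = (\prod_(i <- J) P (A i))%E).

(* sigma-algebra generated by a random variable with values in a finite type *)
Definition discrete_events (T : finType) (X : Omega -> T) : set (set Omega) :=
  preimage_set_system setT X setT.

(* sigma-algebra generated by the coordinates of a random vector *)
Definition vector_events (m : nat) (Z : Omega -> 'rV[R]_m) :
    set (set Omega) :=
  g_sigma_preimage (fun (j : 'I_m) w => Z w ord0 j).

Definition has_pmf (T : finType) (X : Omega -> T) (q : T -> R) : Prop :=
  forall t, measurable (X @^-1` [set t]) /\ P (X @^-1` [set t]) = (q t)%:E.

(* Z ~ N(0, I_m): the coordinates are independent standard normal variables *)
Definition standard_gaussian (m : nat) (Z : Omega -> 'rV[R]_m) : Prop :=
  (forall (j : 'I_m) (B : set R), measurable B ->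
     P ((fun w => Z w ord0 j) @^-1` B) = normal_prob 0 1 B) /\
  mutually_independent (fun j : 'I_m =>
    preimage_set_system setT (fun w => Z w ord0 j) measurable).

End independence.

(* For p_i <= 1 and N >= 1 this is min_i p_i, the default 1 being harmless. *)
Definition p_min (R : realType) (N : nat) (p : 'I_N -> R) : R :=
  \big[Num.min/1]_(i < N) p i.

Section algorithm.
Context {R : realType} {N m : nat}.
Variables (f : 'M[R]_(N, m) -> R) (alpha mu : R) (x0 : 'M[R]_(N, m)).

(* One realization of the randomness and of the iterates: s k is the agent
   active at step k, u k its direction, v i the initial direction of agent i. *)
Variables (s : nat -> 'I_N) (u : nat -> 'M[R]_(N, m)) (v : 'I_N -> 'M[R]_(N, m)).
Variable x : nat -> 'M[R]_(N, m).

(* Most recent step l < k at which agent s k was active, if there is one. *)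
Definition last_activation (k : nat) : option nat :=
  ohead [seq l <- rev (iota 0 k) | s l == s k].

Definition previous_value (k : nat) : R :=
  if last_activation k is Some l then f (x l + mu *: u l)
  else f (x0 + mu *: v (s k)).

Definition gradient_estimate (k : nat) : 'M[R]_(N, m) :=
  ((f (x k + mu *: u k) - previous_value k) / mu) *: u k.

Definition residual_feedback_run : Prop :=
  x 0%N = x0 /\ forall k, x k.+1 = x k - alpha *: gradient_estimate k.

End algorithm.

Section randomness.
Context {d : measure_display} {Omega : measurableType d} {R : realType}.
Context {N m T : nat}.
Variable P : probability Omega R.
Variables (p : 'I_N -> R) (s : nat -> Omega -> 'I_N).
Variables (u : nat -> Omega -> 'M[R]_(N, m)) (v : 'I_N -> Omega -> 'M[R]_(N, m)).
Variable tau : Omega -> 'I_T.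

Definition active_block (k : nat) (w : Omega) : 'rV[R]_m :=
  row (s k w) (u k w).

(* The independent sources of randomness: activations, active blocks of the
   directions, blocks of the initial directions, and the output index. *)
Definition source_events (c : nat + nat + 'I_N + unit) : set (set Omega) :=
  match c with
  | inl (inl (inl k)) => discrete_events (s k)
  | inl (inl (inr k)) => vector_events (active_block k)
  | inl (inr i) => vector_events (fun w => row i (v i w))
  | inr _ => discrete_events tau
  end.

(* The active block being independent of s k means that, conditionally on
   s k = i and on the past, the i-th block of u k is N(0, I_m). *)
Record sampling_model : Prop := SamplingModel {
  activation_law : forall k, has_pmf P (s k) p;
  direction_law : forall k, standard_gaussian P (active_block k);
  direction_support : forall k w i, i != s k w -> row i (u k w) = 0;
  init_law : forall i, standard_gaussian P (fun w => row i (v i w));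
  init_support : forall i w i', i' != i -> row i' (v i w) = 0;
  output_law : has_pmf P tau (fun _ => T%:R^-1);
  sources_independent : mutually_independent P source_events
}.

End randomness.

(* Main.v *)
Require Import Defs.
From HB Require Import structures.
From mathcomp Require Import all_boot all_order all_algebra finmap.
From mathcomp Require Import all_classical all_reals all_analysis.
From mathcomp Require Import measurable_realfun ring lra.

Set Implicit Arguments.
Unset Strict Implicit.
Unset Printing Implicit Defensive.

Import Order.TTheory GRing.Theory Num.Theory.
Import numFieldNormedType.Exports.

Local Open Scope classical_set_scope.
Local Open Scope ring_scope.

(* Let [memory k i] be the function value that agent i would compare with if it
   were active at step k. The pair (x k, memory k) is a Markov chain, so the
   random delay disappears and only one-step independence is needed: the past,
   the active agent s k and its Gaussian block z = active_block k are
   independent.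

   Write e i = f (x k) - memory k i and S = |z|^2. The Lipschitz bound gives
   |G|^2 <= 2 L0^2 S^2 + (2 / mu^2) e (s k)^2 S for the gradient estimate G, and
   next step's e i is, up to a term L0 alpha |G|, the old one, or of size
   L0 mu |z| if i was just active. As every agent is active with probability at
   least q = min p, the sum of the E (e i)^2 contracts by a factor 1 - q^2 / 2,
   up to an additive O(L0^2 mu^2 m), as soon as T exceeds a constant depending
   only on q. Hence E |G|^2 = O(L0^2 m^2), uniformly in k.

   The stale value is independent of z and drops out of E <grad f (x k), G>. What
   is left is E <grad f (x k), u>^2 >= q M2 E |grad f (x k)|^2, where M2 is the
   variance of N(0,1), up to a Taylor error O(L1^2 mu^2 m^2). Summing the descent
   inequality over k gives the rate for large T. For the remaining T the bound
   |grad f|^2 <= N m L0^2 <= m L0^2 / q suffices. *)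

(** * Expectation and independence *)

Section expectation.
Context {d : measure_display} {Omega : measurableType d} {R : realType}.
Variable P : probability Omega R.
Implicit Types (X Y : Omega -> R) (a b : R).

(** Integrability is bundled with the value, so that linearity, monotonicity and products carry both
    along at once. *)
Definition has_expectation X a : Prop :=
  P.-integrable setT (EFin \o X) /\ (\int[P]_w (X w)%:E)%E = a%:E.

Lemma has_expectation_measurable X a :
  has_expectation X a -> measurable_fun setT X.
Proof. by case=> /integrableP[/measurable_EFinP]. Qed.

Lemma has_expectation_eq X Y a b :
  X =1 Y -> a = b -> has_expectation X a -> has_expectation Y b.
Proof. by move=> /funext -> ->. Qed.

Lemma has_expectation_unique X a b :
  has_expectation X a -> has_expectation X b -> a = b.
Proof. by move=> [_ Xa] [_]; rewrite Xa => -[]. Qed.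

Lemma integrable_has_expectation X :
  P.-integrable setT (EFin \o X) -> exists a, has_expectation X a.
Proof.
move=> iX; exists (fine (\int[P]_w (X w)%:E)%E); split => //.
by rewrite fineK//; exact: integrable_fin_num iX.
Qed.

Lemma has_expectation_cst a : has_expectation (fun=> a) a.
Proof.
split; first exact: (finite_measure_integrable_cst P a).
rewrite integral_cst//= -[RHS]mule1; congr (_ * _)%E; exact: probability_setT.
Qed.

Lemma has_expectationD X Y a b : has_expectation X a -> has_expectation Y b ->
  has_expectation (fun w => X w + Y w) (a + b).
Proof.
move=> [iX Xa] [iY Yb]; split; first exact: integrableD iX iY.
under eq_integral do rewrite EFinD.
by rewrite integralD// Xa Yb.
Qed.

Lemma has_expectationZ c X a : has_expectation X a ->
  has_expectation (fun w => c * X w) (c * a).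
Proof.
move=> [iX Xa]; split; first exact: integrableZl iX.
under eq_integral do rewrite EFinM.
by rewrite integralZl// Xa.
Qed.

Lemma has_expectationB X Y a b : has_expectation X a -> has_expectation Y b ->
  has_expectation (fun w => X w - Y w) (a - b).
Proof.
move=> hX /(has_expectationZ (-1)) /(has_expectationD hX).
by apply: has_expectation_eq => [w|]; rewrite mulN1r.
Qed.

Lemma has_expectation_sum (I : Type) (r : seq I) (X : I -> Omega -> R)
    (a : I -> R) : (forall i, has_expectation (X i) (a i)) ->
  has_expectation (fun w => \sum_(i <- r) X i w) (\sum_(i <- r) a i).
Proof.
move=> hX; elim: r => [|i r IH].
  by apply: has_expectation_eq (has_expectation_cst 0) => [w|]; rewrite big_nil.
apply: has_expectation_eq (has_expectationD (hX i) IH) => [w|];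
  by rewrite big_cons.
Qed.

Lemma has_expectation_le X Y a b : has_expectation X a ->
  has_expectation Y b -> (forall w, X w <= Y w) -> a <= b.
Proof.
move=> [iX Xa] [iY Yb] XY; rewrite -lee_fin -Xa -Yb.
by apply: le_integral => // w _; rewrite /= lee_fin.
Qed.

Lemma has_expectation_dominated X Y b : measurable_fun setT X ->
  has_expectation Y b -> (forall w, `|X w| <= Y w) ->
  exists a, has_expectation X a.
Proof.
move=> mX [iY _] XY; apply: integrable_has_expectation.
apply: le_integrable iY => //; first exact/measurable_EFinP.
by move=> w _ /=; rewrite lee_fin (le_trans (XY w))// ler_norm.
Qed.

Definition independent_rv X Y : Prop := forall A B : set R,
  measurable A -> measurable B ->
  P (X @^-1` A `&` Y @^-1` B) = (P (X @^-1` A) * P (Y @^-1` B))%E.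

(* The joint law is the product of the laws, so Fubini applies. *)
Lemma has_expectationM X Y a b : has_expectation X a -> has_expectation Y b ->
  independent_rv X Y -> has_expectation (fun w => X w * Y w) (a * b).
Proof.
move=> hX hY XY.
have mX := has_expectation_measurable hX.
have mY := has_expectation_measurable hY.
have mXY : measurable_fun setT (fun w => (X w, Y w)).
  exact: measurable_fun_pair.
pose XR : {RV P >-> R} := HB.pack X (isMeasurableFun.Build _ _ _ _ X mX).
pose YR : {RV P >-> R} := HB.pack Y (isMeasurableFun.Build _ _ _ _ Y mY).
pose XYR : {RV P >-> (R * R)%type} :=
  HB.pack (fun w => (X w, Y w)) (isMeasurableFun.Build _ _ _ _ _ mXY).
pose PX := distribution P XR; pose PY := distribution P YR.
pose PXY := distribution P XYR.
have prodE A : measurable A -> (PX \x PY)%E A = PXY A.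
  apply: product_measure_unique => B C mB mC.
  by rewrite /PXY /PX /PY /distribution /pushforward /= -XY.
have mM : measurable_fun setT (fun z : R * R => (z.1 * z.2)%:E).
  by apply/measurable_EFinP; exact: measurable_funM.
have distrE (Z : {RV P >-> R}) c : has_expectation Z c ->
    (distribution P Z).-integrable setT (EFin \o id) /\
    (\int[distribution P Z]_x x%:E = c%:E)%E.
  move=> [iZ <-]; split.
    by apply: integrable_pushforward => //; apply/measurable_EFinP.
  by rewrite integral_distribution//; apply/measurable_EFinP.
have [iX eX] := distrE XR a hX; have [iY eY] := distrE YR b hY.
(* Tonelli: the integral of [|x * y|] against the product law factors into two finite integrals. *)
have prod_int : (PX \x PY)%E.-integrable setT (fun z : R * R => (z.1 * z.2)%:E).
  apply/integrable12ltyP => //=.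
  under eq_integral => x _.
    under eq_integral do rewrite normrM EFinM.
    rewrite ge0_integralZl//; last by apply/measurable_EFinP.
    over.
  move/integrableP : iX => [_ iX]; move/integrableP : iY => [_ iY].
  rewrite /= ge0_integralZr//; last 2 first.
  - by apply/measurable_EFinP.
  - exact: integral_ge0.
  apply: lte_mul_pinfty => //; first exact: integral_ge0.
  by rewrite ge0_fin_numE//; exact: integral_ge0.
have [iPXY ePXY] : PXY.-integrable setT (fun z : R * R => (z.1 * z.2)%:E) /\
    (\int[PXY]_z (z.1 * z.2)%:E = (a * b)%:E)%E.
  split.
    move: prod_int => /integrableP[_ prod_oo]; apply/integrableP; split => //.
    rewrite (eq_measure_integral (PX \x PY)%E)// => A mA _; exact/esym/prodE.
  rewrite (eq_measure_integral (PX \x PY)%E); last first.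
    by move=> A mA _; exact/esym/prodE.
  rewrite -integral12_prod_meas1//= /fubini_F/=.
  under eq_integral => x _.
    under eq_integral do rewrite EFinM.
    rewrite integralZl// eY.
    over.
  by rewrite /= integralZr// eX.
have iXY : P.-integrable setT (EFin \o (fun w => X w * Y w)).
  apply/integrableP; split; first exact/measurable_EFinP/measurable_funM.
  move/integrableP : iPXY => [_]; rewrite ge0_integral_distribution//.
  exact: measurableT_comp.
split => //; rewrite -ePXY integral_distribution//.
Qed.

Definition normal_law (X : Omega -> R) : Prop :=
  measurable_fun setT X /\
  forall B, measurable B -> P (X @^-1` B) = normal_prob 0 1 B.

End expectation.

(** * Independence of one source from the sigma-algebra of several others *)

Section grouping.
Context {d : measure_display} {Omega : measurableType d} {R : realType}.
Variable P : probability Omega R.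

Lemma mutually_independent_pair (I : choiceType) (E : I -> set (set Omega))
    i j A B : mutually_independent P E -> i != j -> E i A -> E j B ->
  P (A `&` B) = (P A * P B)%E.
Proof.
move=> [_ ind] ij EA EB.
have := ind [fset i; j]%fset (fun k => if k == i then A else B).
have ji : (j == i) = false by rewrite eq_sym (negbTE ij).
rewrite big_fsetU1 ?inE//= big_seq_fset1 eqxx ji => <-; last first.
  by move=> k; rewrite !inE => /orP[] /eqP->; rewrite ?eqxx ?ji.
congr (P _); apply/seteqP; split=> [w [Aw Bw] k /= _|w AB]; first by case: ifP.
split.
  by have := AB i; rewrite /= !inE eqxx => /(_ isT).
by have := AB j; rewrite /= !inE eqxx ji orbT => /(_ isT).
Qed.

(* By Dynkin's theorem it is enough to take for [A] a finite intersection of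
   events of the [E i] with [i] in [D]. *)
Lemma mutually_independent_group (I : choiceType) (E : I -> set (set Omega))
    (D : set I) (c : I) : mutually_independent P E ->
  (forall i, setI_closed (E i)) -> ~ D c ->
  forall A B, <<s \bigcup_(i in D) E i >> A -> E c B ->
  P (A `&` B) = (P A * P B)%E.
Proof.
move=> [Em ind] EI Dc A B sA EB.
pose G := [set A | exists (J : {fset I}) (F : I -> set Omega),
  [/\ {in J, forall i, D i}, {in J, forall i, E i (F i)} &
      A = \bigcap_(i in [set` J]) F i]].
have mB : measurable B := Em _ _ EB.
(* The claim is the equality at [A] of two finite measures, [P] restricted to [B] and [P] scaled by
   [P B]; they are compared on the pi-system [G]. *)
pose m1 := mrestr P mB.
have PB : P B \is a fin_num by exact: fin_num_measure.
pose m2 := mscale (NngNum (fine_ge0 (measure_ge0 P B))) P.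
have Gm : G `<=` measurable.
  move=> _ [J [F [JD JF ->]]].
  apply: fin_bigcap_measurable => [|i iJ]; first exact: finite_fset.
  exact/Em/JF.
suff : m1 A = m2 A.
  by rewrite /m1 /mrestr /m2 /mscale /= fineK// muleC => ->.
apply: (@g_sigma_algebra_measure_unique _ R Omega G Gm (fun=> setT) _ _ m1 m2).
- move=> _; exists fset0, (fun=> setT); split => //.
  by rewrite set_fset0 bigcap_set0.
- by rewrite bigcup_const//; exact: I.
- move=> _ _ [J [F [JD JF ->]]] [J' [F' [J'D J'F' ->]]].
  (* An index in both sets receives the intersection of its two events, again in [E i] by [EI]. *)
  exists (J `|` J')%fset, (fun i => if i \in J then
      if i \in J' then F i `&` F' i else F i else F' i); split.
  + by move=> i; rewrite in_fsetU => /orP[/JD|/J'D].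
  + move=> i; rewrite in_fsetU.
    case: ifPn => iJ /=; last by move=> /J'F'.
    by case: ifPn => [/J'F' EF'|_] _; [apply: EI => //; exact: JF|exact: JF].
  + apply/seteqP; split=> [w [JFw J'Fw] i /=|w JJ'w].
      rewrite in_fsetU; case: ifPn => iJ /=; last by move=> iJ'; exact: J'Fw.
      by case: ifPn => [iJ'|_] _; [split; [exact: JFw|exact: J'Fw]|exact: JFw].
    split=> i /= iJ; have := JJ'w i; rewrite /= in_fsetU iJ ?orbT => /(_ isT).
      by case: ifP => // _ [].
    by case: ifP => // _ [].
- move=> _ [J [F [JD JF ->]]].
  have cJ i : i \in J -> (i == c) = false.
    by move=> iJ; apply/negP => /eqP ic; apply: Dc; rewrite -ic; exact: JD.
  (* Since [c] lies outside [D], hence outside [J], it can be adjoined with event [B]; mutual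
     independence then factors out [P B]. *)
  have := ind (c |` J)%fset (fun i => if i == c then B else F i).
  rewrite big_fsetU1/=; last by apply/negP => /cJ; rewrite eqxx.
  rewrite eqxx.
  rewrite (eq_big_seq (P \o F)) => [|i /cJ /= -> //].
  rewrite /= -ind// => indc.
  rewrite /m1 /mrestr /m2 /mscale /= fineK// -indc => [|i].
    congr (P _); apply/seteqP; split=> [w [JFw Bw] i /=|w cJw].
      by rewrite !inE => /orP[/eqP->|iJ]; [rewrite eqxx|rewrite cJ//; exact: JFw].
    split=> [i /= iJ|].
      by have := cJw i; rewrite /= !inE iJ orbT cJ// => /(_ isT).
    by have := cJw c; rewrite /= !inE eqxx => /(_ isT).
  rewrite !inE => /orP[/eqP->|iJ]; first by rewrite eqxx.
  by rewrite /= cJ//; exact: JF.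
- move=> _; rewrite /= /mrestr setTI.
  by apply: (le_lt_trans (probability_le1 P mB)); rewrite ltry.
- apply: sub_sigma_algebra2 sA => A' [i Di EA'].
  exists [fset i]%fset, (fun=> A'); split.
  + by move=> j; rewrite inE => /eqP->.
  + by move=> j; rewrite inE => /eqP->.
  + apply/seteqP; split=> [w Aw j//|w /(_ i)]; apply; exact: fset11.
Qed.

End grouping.

(** * Measurability of Lipschitz functions and of the iterates *)

Section enorm.
Context {R : realType} {N m : nat}.
Implicit Types x y : 'M[R]_(N, m).

Lemma enorm_ge0 x : 0 <= enorm x. Proof. exact: sqrtr_ge0. Qed.

Lemma enorm_sqr x : enorm x ^+ 2 = \sum_(i < N) \sum_(j < m) x i j ^+ 2.
Proof.
by rewrite sqr_sqrtr//; do 2!apply: sumr_ge0 => ? _; exact: sqr_ge0.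
Qed.

Lemma enormZ c x : enorm (c *: x) = `|c| * enorm x.
Proof.
rewrite /enorm -sqrtr_sqr -sqrtrM ?sqr_ge0// mulr_sumr.
congr Num.sqrt; apply: eq_bigr => i _; rewrite mulr_sumr.
by apply: eq_bigr => j _; rewrite mxE exprMn.
Qed.

Lemma enorm_le_sup x e : 0 <= e -> (forall i j, `|x i j| <= e) ->
  enorm x ^+ 2 <= (N * m)%:R * e ^+ 2.
Proof.
move=> e0 xe; rewrite enorm_sqr.
have -> : (N * m)%:R * e ^+ 2 = \sum_(i < N) \sum_(j < m) e ^+ 2 :> R.
  by rewrite !sumr_const !card_ord -mulrnA mulr_natl mulnC.
do 2!apply: ler_sum => ? _.
by rewrite -(real_normK (num_real _)) lerXn2r ?nnegrE.
Qed.

End enorm.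

(** Only coordinatewise measurability of [h] enters, and [Omega] is arbitrary, so the lemma also
    applies with the sigma-algebra of the past in place of the ambient one. *)
Lemma elipschitz_measurable (R : realType) (N m : nat) (L : R)
    (g : 'M[R]_(N, m) -> R) (d : measure_display) (Omega : measurableType d)
    (h : Omega -> 'M[R]_(N, m)) : elipschitz L g ->
  (forall i j, measurable_fun setT (fun w => h w i j)) ->
  measurable_fun setT (fun w => g (h w)).
Proof.
move=> gL mh.
pose L' := `|L| + 1.
have L'0 : 0 < L' by rewrite ltr_wpDl.
have gL' x y : `|g x - g y| <= L' * enorm (x - y).
  apply: (le_trans (gL x y)); apply: ler_wpM2r; first exact: enorm_ge0.
  by rewrite (le_trans (ler_norm L))// lerDl.
have mhq (q : 'M[R]_(N, m)) : measurable_fun setT (fun w => enorm (h w - q)).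
  apply: (measurableT_comp (continuous_measurable_fun (@sqrt_continuous R))).
  apply: measurable_sum => i; apply: measurable_sum => j.
  under eq_fun do rewrite !mxE.
  by apply: measurable_funX; apply: measurable_funB => //; exact: mh.
apply: (measurability _ (RGenInftyO.measurableE R)) => //.
move=> _ [_ [a ->] <-]; rewrite setTI.
pose emb (q : 'M[rat]_(N, m)) : 'M[R]_(N, m) := map_mx (@ratr R) q.
(* g y < a iff g q + L' |y - q| < a for some rational matrix q close to y. *)
have -> : (fun w => g (h w)) @^-1` `]-oo, a[%classic =
    \bigcup_(q : 'M[rat]_(N, m))
      [set w | g (emb q) + L' * enorm (h w - emb q) < a].
  apply/seteqP; split=> [w /=|w [q _ /=]]; rewrite in_itv/=; last first.
    apply: le_lt_trans; rewrite -lerBlDl (le_trans (ler_norm _))//.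
  (* Half of the gap [a - g (h w)] pays for [g (emb q)] exceeding [g (h w)], the other half for the
     added distance. The extra 1 in [c] makes the bound on the norm strict and avoids division by
     0. *)
  move=> ha; pose e := (a - g (h w)) / (2 * L').
  have e0 : 0 < e by rewrite divr_gt0 ?mulr_gt0// subr_gt0.
  pose c : R := (N * m)%:R + 1.
  have c0 : 0 < c by rewrite ltr_wpDl.
  pose del := e / c.
  have del0 : 0 < del by rewrite divr_gt0.
  have qP i j : exists q : rat, `|h w i j - ratr q| <= del.
    have /rat_in_itvoo[q] : h w i j - del < h w i j + del by lra.
    by rewrite in_itv/= => /andP[? ?];
      exists q; rewrite ler_distlC; apply/andP; split; lra.
  pose q : 'M[rat]_(N, m) := \matrix_(i, j) projT1 (cid (qP i j)).
  exists q => //=.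
  have dq : enorm (h w - emb q) < e.
    rewrite -(ltr_pXn2r (_ : 0 < 2)%N) ?nnegrE ?enorm_ge0 ?(ltW e0)//.
    have := @enorm_le_sup _ _ _ (h w - emb q) del (ltW del0).
    have qdel i j : `|(h w - emb q) i j| <= del.
      by rewrite !mxE; case: cid.
    move=> /(_ qdel) /le_lt_trans; apply.
    rewrite /del expr_div_n mulrCA gtr_pMr ?exprn_gt0//.
    rewrite ltr_pdivrMr ?exprn_gt0// mul1r.
    have : 0 <= (N * m)%:R :> R by [].
    rewrite /c; nra.
  have := gL' (h w) (emb q); rewrite distrC => /ler_normlW gg.
  have : L' * enorm (h w - emb q) < (a - g (h w)) / 2.
    have -> : (a - g (h w)) / 2 = L' * e by rewrite /e; field; exact: lt0r_neq0.
    by rewrite ltr_pM2l.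
  lra.
apply: countable_bigcupT_measurable => // q.
rewrite -[X in measurable X]setTI -preimage_itvNyo.
apply: measurable_funD => //; exact: measurable_funM.
Qed.

(** * The algorithm as a recursion on iterates and per-agent memories *)

Section memory.
Context {R : realType} {N m : nat}.
Variables (f : 'M[R]_(N, m) -> R) (alpha mu : R) (x0 : 'M[R]_(N, m)).
Variables (s : nat -> 'I_N) (u : nat -> 'M[R]_(N, m)) (v : 'I_N -> 'M[R]_(N, m)).
Variable x : nat -> 'M[R]_(N, m).

Fixpoint memory (k : nat) (i : 'I_N) : R :=
  if k is l.+1 then
    if s l == i then f (x l + mu *: u l) else memory l i
  else f (x0 + mu *: v i).

(** Splitting the last index off [iota 0 k] puts it at the head of the reversed list, which is
    exactly the case distinction made by [memory]. The agent is generalized first because it must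
    stay fixed while [k] decreases. *)
Lemma previous_value_memory k :
  previous_value f mu x0 s u v x k = memory k (s k).
Proof.
rewrite /previous_value /last_activation; move: (s k) => i.
elim: k => [//|k IH]; rewrite -[in iota _ _]addn1 iotaD rev_cat /= add0n.
by case: eqP => [<-|].
Qed.

Lemma residual_feedback_step k : residual_feedback_run f alpha mu x0 s u v x ->
  x k.+1 = x k - (alpha * ((f (x k + mu *: u k) - memory k (s k)) / mu)) *: u k.
Proof.
by case=> _ ->; rewrite /gradient_estimate previous_value_memory scalerA.
Qed.

End memory.

(** Measurability is assumed of steps before [k] only, over any sigma-algebra; this yields
    adaptedness of the iterates to the past, not just their measurability. *)
Lemma run_measurable (R : realType) (N m : nat) (L : R) (f : 'M[R]_(N, m) -> R)
    (alpha mu : R) (x0 : 'M[R]_(N, m)) (d : measure_display)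
    (Omega : measurableType d) (s : nat -> Omega -> 'I_N)
    (u : nat -> Omega -> 'M[R]_(N, m)) (v : 'I_N -> Omega -> 'M[R]_(N, m))
    (x : nat -> Omega -> 'M[R]_(N, m)) (k : nat) : elipschitz L f ->
  (forall w, residual_feedback_run f alpha mu x0
     (s ^~ w) (u ^~ w) (v ^~ w) (x ^~ w)) ->
  (forall l i, (l < k)%N -> measurable [set w | s l w = i]) ->
  (forall l i j, (l < k)%N -> measurable_fun setT (fun w => u l w i j)) ->
  (forall i i' j, measurable_fun setT (fun w => v i w i' j)) ->
  (forall i j, measurable_fun setT (fun w => x k w i j)) /\
  (forall i, measurable_fun setT
     (fun w => memory f mu x0 (s ^~ w) (u ^~ w) (v ^~ w) (x ^~ w) k i)).
Proof.
move=> fL run; elim: k => [_ _ mv|k IH ms mum mv].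
  split=> [i j|i /=].
    rewrite (_ : (fun w => _) = cst (x0 i j)); first exact: measurable_cst.
    by apply/funext => w; rewrite (proj1 (run w)).
  apply: (elipschitz_measurable fL) => i' j; under eq_fun do rewrite !mxE.
  by apply: measurable_funD => //; exact: measurable_funM.
have [mx mmem] := IH (fun l i lk => ms l i (ltnW lk))
  (fun l i j lk => mum l i j (ltnW lk)) mv.
have mchi i : measurable_fun setT (fun w => (s k w == i)%:R : R).
  have := @measurable_indic _ _ R setT _ (ms k i (ltnSn k)).
  apply: eq_measurable_fun => w _; rewrite indicE; congr (_%:R).
  by congr nat_of_bool; apply/idP/eqP; rewrite inE.
have mfu : measurable_fun setT (fun w => f (x k w + mu *: u k w)).
  apply: (elipschitz_measurable fL) => i' j; under eq_fun do rewrite !mxE.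
  apply: measurable_funD; first exact: mx.
  by apply: measurable_funM => //; exact: mum.
split=> [i j|i /=].
  under eq_fun => w.
    rewrite (residual_feedback_step _ (run w)) !mxE.
    (* The memory is read at the random agent [s k w]; a sum weighted by indicators reduces it to
       memories of fixed agents. *)
    rewrite [memory _ _ _ _ _ _ _ _ _](_ : _ = \sum_(i' < N) (s k w == i')%:R *
      memory f mu x0 (s ^~ w) (u ^~ w) (v ^~ w) (x ^~ w) k i'); last first.
      rewrite (bigD1 (s k w))//= eqxx mul1r big1 ?addr0// => i' /negbTE.
      by rewrite eq_sym => ->; rewrite mul0r.
    over.
  apply: measurable_funB; first exact: mx.
  apply: measurable_funM; last exact: mum.
  apply: measurable_funM => //; apply: measurable_funM => //.
  apply: measurable_funB => //; apply: measurable_sum => i'.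
  by apply: measurable_funM.
rewrite (_ : (fun w => _) = (fun w => (s k w == i)%:R * f (x k w + mu *: u k w)
    + (1 - (s k w == i)%:R) *
      memory f mu x0 (s ^~ w) (u ^~ w) (v ^~ w) (x ^~ w) k i)); last first.
  apply/funext => w /=; case: (s k w == i).
    by rewrite mul1r subrr mul0r addr0.
  by rewrite mul0r add0r subr0 mul1r.
apply: measurable_funD; apply: measurable_funM => //.
exact: measurable_funB.
Qed.

(** * The history of the algorithm and its independence of the next step *)

Lemma subset_bigsetU_ord (A : Type) (n : nat) (F : 'I_n -> set A) (j : 'I_n) :
  F j `<=` \big[setU/set0]_(i < n) F i.
Proof. by rewrite (bigD1 j)//=; exact: subsetUl. Qed.

Section sampling.
Context {d : measure_display} {Omega : measurableType d} {R : realType}.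
Context {N m T : nat} {P : probability Omega R} {p : 'I_N -> R}.
Context {s : nat -> Omega -> 'I_N} {u : nat -> Omega -> 'M[R]_(N, m)}.
Context {v : 'I_N -> Omega -> 'M[R]_(N, m)} {tau : Omega -> 'I_T}.
Hypothesis model : sampling_model P p s u v tau.

Let source := source_events s u v tau.

(** These are the sources that determine the iterate and the memories at step [k]. The output index
    is left out, so it is independent of every past. *)
Definition past (k : nat) : set (nat + nat + 'I_N + unit) := [set c |
  match c with
  | inl (inl (inl l)) | inl (inl (inr l)) => (l < k)%N
  | inl (inr _) => true
  | inr _ => false
  end].

(** A copy of [Omega] with a smaller sigma-algebra: being [measurable_fun] on it means being
    determined by the sources in [D]. *)
Definition generated (D : set (nat + nat + 'I_N + unit)) : Type :=
  g_sigma_algebraType (\bigcup_(c in D) source c).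

HB.instance Definition _ D := Measurable.on (generated D).

(** The generators are spelled out as in [vector_events], so that measurable sets of this type are
    events of the source of the active block. *)
Definition block_generated (k : nat) : Type := g_sigma_algebraType
  (\big[setU/set0]_(j < m) preimage_set_system setT
    (fun w => active_block s u k w ord0 j) measurable).

HB.instance Definition _ k := Measurable.on (block_generated k).

Lemma source_events_setI c : setI_closed (source c).
Proof.
have discreteI (I : finType) (X : Omega -> I) : setI_closed (discrete_events X).
  move=> _ _ [A _ <-] [B _ <-]; exists (A `&` B) => //.
  by rewrite !setTI preimage_setI.
case: c => [[[k|k]|i]|[]] => /=; [exact: discreteI| | |exact: discreteI].
- by move=> A B; exact: (@measurableI _ (g_sigma_algebraType _)).
- by move=> A B; exact: (@measurableI _ (g_sigma_algebraType _)).
Qed.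

Lemma independent_source D c (X Y : Omega -> R) : ~ D c ->
  measurable_fun (setT : set (generated D)) X ->
  (forall B, measurable B -> source c (Y @^-1` B)) -> independent_rv P X Y.
Proof.
move=> Dc mX mY A B mA mB.
apply: (mutually_independent_group (sources_independent model)
  source_events_setI Dc) => //; last exact: mY.
by have := mX measurableT A mA; rewrite setTI.
Qed.

Lemma discrete_events_activation k i (B : set R) :
  source (inl (inl (inl k))) ((fun w => (s k w == i)%:R : R) @^-1` B).
Proof. by exists [set j | B (j == i)%:R] => //; rewrite setTI. Qed.

Lemma measurable_source c A : source c A -> measurable A.
Proof. by have [+ _] := sources_independent model; apply. Qed.

Lemma has_expectation_activation k i :
  has_expectation P (fun w => (s k w == i)%:R) (p i).
Proof.
have [ms Ps] := activation_law model k i.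
have eqI : (fun w => (s k w == i)%:R) = \1_(s k @^-1` [set i]) :> (Omega -> R).
  apply/funext => w; rewrite indicE; congr (_%:R).
  by congr nat_of_bool; apply/eqP/idP; rewrite inE.
rewrite eqI; split; last by rewrite -Ps integral_indic// setIT.
by apply: integrable_indic.
Qed.

Lemma generated_sub D D' (X : Omega -> R) : D `<=` D' ->
  measurable_fun (setT : set (generated D)) X ->
  measurable_fun (setT : set (generated D')) X.
Proof.
move=> DD' mX _ B mB; have := mX measurableT B mB.
by apply: sub_sigma_algebra2; exact: bigcup_subset.
Qed.

Lemma measurable_generated_activation D k i : D (inl (inl (inl k))) ->
  measurable (([set w | s k w = i]) : set (generated D)).
Proof.
move=> Dk; apply: sub_sigma_algebra; exists (inl (inl (inl k))) => //.
by exists [set i] => //; rewrite setTI.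
Qed.

Lemma measurable_generated_chi D k i : D (inl (inl (inl k))) ->
  measurable_fun (setT : set (generated D)) (fun w => (s k w == i)%:R : R).
Proof.
move=> Dk _ B mB; apply: sub_sigma_algebra; exists (inl (inl (inl k))) => //.
by rewrite setTI; exact: discrete_events_activation.
Qed.

(** Independence is applied twice: the past against the activation, then both together against the
    Gaussian block. All expectations of one step reduce to sums of such products. *)
Lemma has_expectation_step k i (X Y : Omega -> R) a b :
  measurable_fun (setT : set (generated (past k))) X ->
  measurable_fun (setT : set (block_generated k)) Y ->
  has_expectation P X a -> has_expectation P Y b ->
  has_expectation P (fun w => X w * (s k w == i)%:R * Y w) (a * p i * b).
Proof.
move=> mX mY hX hY.
have hXs : has_expectation P (fun w => X w * (s k w == i)%:R) (a * p i).
  apply: has_expectationM hX (has_expectation_activation k i) _.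
  apply: (@independent_source (past k) (inl (inl (inl k)))) => //=.
    by rewrite ltnn.
  by move=> B mB; exact: discrete_events_activation.
apply: has_expectationM hXs hY _.
(* The activation of step [k] now belongs to the known sources, and the block is the new one. *)
apply: (@independent_source (past k `|` [set inl (inl (inl k))])
  (inl (inl (inr k)))).
- by move=> [/=|//]; rewrite ltnn.
- apply: measurable_funM; first by apply: generated_sub mX => c; left.
  by apply: measurable_generated_chi; right.
- by move=> B mB; have := mY measurableT B mB; rewrite setTI.
Qed.

Lemma block_generated_coord k j : measurable_fun
  (setT : set (block_generated k)) (fun w => active_block s u k w ord0 j).
Proof.
move=> _ B mB; apply: sub_sigma_algebra.
apply: (@subset_bigsetU_ord _ _ (fun j => preimage_set_system setT
  (fun w => active_block s u k w ord0 j) measurable) j).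
by exists B.
Qed.

Lemma directionE l w i j :
  u l w i j = (s l w == i)%:R * active_block s u l w ord0 j.
Proof.
rewrite /active_block mxE; case: eqP => [<-|/eqP]; first by rewrite mul1r.
rewrite eq_sym mul0r => /(direction_support model) /rowP /(_ j).
by rewrite !mxE.
Qed.

Lemma measurable_generated_direction D k i j :
  D (inl (inl (inl k))) -> D (inl (inl (inr k))) ->
  measurable_fun (setT : set (generated D)) (fun w => u k w i j).
Proof.
move=> Ds Du; rewrite (funext (fun w => directionE k w i j)).
apply: measurable_funM; first exact: measurable_generated_chi.
move=> _ B mB; apply: sub_sigma_algebra; exists (inl (inl (inr k))) => //=.
exact: (@block_generated_coord k j measurableT B mB).
Qed.

Lemma initE i w i' j : v i w i' j = (i' == i)%:R * row i (v i w) ord0 j.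
Proof.
rewrite mxE; case: eqP => [->|/eqP]; first by rewrite mul1r.
by rewrite mul0r => /(init_support model w) /rowP /(_ j); rewrite !mxE.
Qed.

Lemma measurable_generated_init D i i' j : D (inl (inr i)) ->
  measurable_fun (setT : set (generated D)) (fun w => v i w i' j).
Proof.
move=> Di; rewrite (funext (fun w => initE i w i' j)).
apply: measurable_funM => //.
move=> _ B mB; apply: sub_sigma_algebra; exists (inl (inr i)) => //=.
apply: sub_sigma_algebra.
apply: (@subset_bigsetU_ord _ _ (fun j => preimage_set_system setT
  (fun w => row i (v i w) ord0 j) measurable) j).
by exists B.
Qed.

Lemma measurable_run_past (L : R) (f : 'M[R]_(N, m) -> R) (alpha mu : R)
    (x0 : 'M[R]_(N, m)) (x : nat -> Omega -> 'M[R]_(N, m)) k :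
  elipschitz L f ->
  (forall w, residual_feedback_run f alpha mu x0
     (s ^~ w) (u ^~ w) (v ^~ w) (x ^~ w)) ->
  (forall i j, measurable_fun (setT : set (generated (past k)))
    (fun w => x k w i j)) /\
  (forall i, measurable_fun (setT : set (generated (past k)))
     (fun w => memory f mu x0 (s ^~ w) (u ^~ w) (v ^~ w) (x ^~ w) k i)).
Proof.
move=> fL run.
apply: (@run_measurable _ _ _ _ _ _ _ _ _ (generated (past k)) _ _ _ _ _ fL run).
- by move=> l i lk; exact: measurable_generated_activation.
- by move=> l i j lk; apply: measurable_generated_direction.
- by move=> i i' j; exact: measurable_generated_init.
Qed.

Lemma measurable_generatedW D (X : Omega -> R) :
  measurable_fun (setT : set (generated D)) X -> measurable_fun setT X.
Proof.
move=> mX _ B mB; have := mX measurableT B mB; move: (_ `&` _) => A; apply.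
split; first exact: sigma_algebra_measurable.
by move=> A' [c _ cA']; exact: measurable_source cA'.
Qed.

(** Split according to the value of [tau]: each indicator has mean [T%:R^-1] and is independent of
    the past, which does not contain the source [inr tt]. *)
Lemma has_expectation_output k (X : 'I_T -> Omega -> R) (a : 'I_T -> R) :
  (forall t, measurable_fun (setT : set (generated (past k))) (X t)) ->
  (forall t, has_expectation P (X t) (a t)) ->
  has_expectation P (fun w => X (tau w) w) (T%:R^-1 * \sum_(t < T) a t).
Proof.
move=> mX hX.
have htau t : has_expectation P (fun w => (tau w == t)%:R) T%:R^-1.
  have [mt Pt] := output_law model t.
  have -> : (fun w => (tau w == t)%:R) = \1_(tau @^-1` [set t]) :> (Omega -> R).
    apply/funext => w; rewrite indicE; congr (_%:R).
    by congr nat_of_bool; apply/eqP/idP; rewrite inE.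
  split; last by rewrite -Pt integral_indic// setIT.
  exact: integrable_indic.
have : has_expectation P (fun w => \sum_(t < T) X t w * (tau w == t)%:R)
    (\sum_(t < T) a t * T%:R^-1).
  apply: has_expectation_sum => t; apply: has_expectationM (hX t) (htau t) _.
  apply: (@independent_source (past k) (inr tt)) => // B mB /=.
  by exists [set t' | B (t' == t)%:R] => //; rewrite setTI.
apply: has_expectation_eq => [w|]; last by rewrite -mulr_suml mulrC.
rewrite (bigD1 (tau w))//= eqxx mulr1 big1 ?addr0// => t /negbTE.
by rewrite eq_sym => ->; rewrite mulr0.
Qed.

Lemma active_block_normal k j :
  normal_law P (fun w => active_block s u k w ord0 j).
Proof.
split; last by have [+ _] := direction_law model k; apply.
move=> _ B mB; apply: (measurable_source (c := inl (inl (inr k)))).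
exact: (@block_generated_coord k j measurableT B mB).
Qed.

Lemma active_block_independent k j j' : j != j' ->
  independent_rv P (fun w => active_block s u k w ord0 j)
    (fun w => active_block s u k w ord0 j').
Proof.
move=> jj' A B mA mB; have [_ ind] := direction_law model k.
by apply: (mutually_independent_pair ind jj'); [exists A|exists B] => //;
  rewrite setTI.
Qed.

Lemma init_normal i j : normal_law P (fun w => v i w i j).
Proof.
split.
  by apply: (@measurable_generatedW setT); exact: measurable_generated_init.
move=> B mB; have [+ _] := init_law model i => /(_ j B mB) <-.
by congr (P _); apply/funext => w; rewrite /preimage /= mxE.
Qed.

End sampling.

(** * Moments of the standard normal law *)

Section normal_moments.
Variable R : realType.
Local Notation mu := (@lebesgue_measure R).
Local Notation nu := (@normal_prob R 0 1).

(** The Radon-Nikodym derivative of the normal law has the same integral over every measurable set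
    as [normal_pdf], so the two agree almost everywhere. *)
Lemma ge0_integral_normal_prob (f : R -> \bar R) : measurable_fun setT f ->
  (forall x, 0 <= f x)%E ->
  (\int[nu]_x f x = \int[mu]_x (f x * (normal_pdf 0 1 x)%:E))%E.
Proof.
move=> mf f0.
have dom : nu `<< mu by exact: normal_prob_dominates.
rewrite -(Radon_Nikodym_SigmaFinite.change_of_variables dom)//.
have mg : measurable_fun setT (Radon_Nikodym_SigmaFinite.f nu mu).
  by apply: (measurable_int mu); exact: Radon_Nikodym_SigmaFinite.f_integrable.
have mpdf : measurable_fun setT (fun x => (normal_pdf (0 : R) 1 x)%:E).
  by apply/measurable_EFinP; exact: measurable_normal_pdf.
apply: ge0_ae_eq_integral => //.
- exact: emeasurable_funM.
- exact: emeasurable_funM.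
- move=> x _; apply: mule_ge0; first exact: f0.
  exact: Radon_Nikodym_SigmaFinite.f_ge0.
- by move=> x _; apply: mule_ge0; rewrite ?lee_fin ?normal_pdf_ge0.
- apply: ae_eqe_mul2l; apply: integral_ae_eq => //.
    exact: Radon_Nikodym_SigmaFinite.f_integrable.
  by move=> A _ mA; rewrite -Radon_Nikodym_SigmaFinite.f_integral.
Qed.

(** By uniqueness of Lebesgue measure it suffices to look at half-open intervals; reflection only
    moves the closed end to the other side. *)
Lemma lebesgue_measure_opp (A : set R) : measurable A ->
  mu (-%R @^-1` A) = mu A.
Proof.
move=> mA.
have mN : measurable_fun setT (-%R : measurableTypeR R -> measurableTypeR R).
  exact: measurable_funN.
pose N : {mfun measurableTypeR R >-> measurableTypeR R} :=
  HB.pack -%R (isMeasurableFun.Build _ _ _ _ _ mN).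
apply/esym; apply: (@lebesgue_measure_unique R (pushforward mu N)) => //.
move=> _ [[a b] _ <-]; rewrite [RHS]/(mu (-%R @^-1` `]a, b]%classic)).
have -> : -%R @^-1` `]a, b]%classic = `[- b, - a[%classic :> set R.
  by apply/seteqP; split=> x /=; rewrite !in_itv/= lerNl ltrNr andbC.
rewrite lebesgue_measure_itv [RHS](@lebesgue_measure_itv R `[- b, - a[).
by rewrite /= !lte_fin ltrN2 opprK -!EFinD addrC.
Qed.

Lemma normal_prob_opp (A : set R) : measurable A -> nu (-%R @^-1` A) = nu A.
Proof.
move=> mA; rewrite /normal_prob.
have mN : measurable_fun setT (-%R : measurableTypeR R -> measurableTypeR R).
  exact: measurable_funN.
pose N : {mfun measurableTypeR R >-> measurableTypeR R} :=
  HB.pack -%R (isMeasurableFun.Build _ _ _ _ _ mN).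
rewrite [RHS](eq_measure_integral (pushforward mu N)); last first.
  by move=> B mB _; apply/esym; exact: lebesgue_measure_opp.
rewrite ge0_integral_pushforward//.
- apply: eq_integral => x _ /=; congr (_%:E).
  by rewrite !normal_pdfE ?oner_neq0// /normal_fun !subr0 sqrrN.
- by apply/measurable_EFinP/measurable_funTS; exact: measurable_normal_pdf.
- by move=> x _; rewrite lee_fin normal_pdf_ge0.
Qed.

(** Dominating by a multiple of the density with standard deviation 2 gives a finite fourth moment
    without computing it. *)
Lemma normal_fourth_moment_bound (x : R) :
  x ^+ 4 * normal_pdf 0 1 x <=
  64 * (normal_peak 1 / normal_peak 2) * normal_pdf 0 2 x.
Proof.
have p2 : 0 < @normal_peak R 2 by rewrite normal_peak_gt0.
rewrite !normal_pdfE ?oner_neq0 ?pnatr_eq0// /normal_fun !subr0.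
rewrite [leRHS](_ : _ =
  normal_peak 1 * (64 * expR (- x ^+ 2 / (2 ^+ 2 *+ 2)))); last first.
  by field; exact: lt0r_neq0.
rewrite mulrCA ler_wpM2l ?normal_peak_ge0//.
(* In this variable the two exponentials are [expR (- t)] to the powers 4 and 1, and [x ^+ 4] is
   [64 * t ^+ 2]; two factors of the former absorb [t ^+ 2] through [t * expR (- t) <= 1]. *)
pose t := x ^+ 2 / 8.
have t0 : 0 <= t by rewrite divr_ge0 ?sqr_ge0.
have -> : - x ^+ 2 / (1 ^+ 2 *+ 2) = - t + - t + - t + - t by rewrite /t; field.
have -> : - x ^+ 2 / (2 ^+ 2 *+ 2) = - t by rewrite /t; field.
have -> : x ^+ 4 = 64 * t ^+ 2 by rewrite /t; field.
rewrite -mulrA ler_wpM2l// !expRD.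
have e0 : 0 < expR (- t) by exact: expR_gt0.
have te : t * expR (- t) <= 1.
  rewrite expRN ler_pdivrMr ?expR_gt0// mul1r.
  by apply: le_trans (expR_ge1Dx t); rewrite lerDr.
have e1 : expR (- t) <= 1 by rewrite -expR0 ler_expR oppr_le0.
have te0 : 0 <= t * expR (- t) by rewrite mulr_ge0// ltW.
set e := expR (- t) in e0 te e1 te0 *.
have -> : t ^+ 2 * (e * e * e * e) = (t * e) ^+ 2 * (e * e) by ring.
have te2 : (t * e) ^+ 2 <= 1 by rewrite expr_le1.
have ee : e * e <= e by rewrite ger_pMl.
by apply: le_trans ee; rewrite ger_pMl// mulr_gt0.
Qed.

Lemma normal_fourth_moment : nu.-integrable setT (fun x => (x ^+ 4)%:E).
Proof.
apply/integrableP; split.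
  by apply/measurable_EFinP; exact: measurable_funX.
rewrite ge0_integral_normal_prob//; last first.
  by apply: measurableT_comp => //; apply/measurable_EFinP; exact: measurable_funX.
apply: (@le_lt_trans _ _
  (\int[mu]_x (64 * (normal_peak 1 / normal_peak 2) * normal_pdf 0 2 x)%:E)%E).
  apply: ge0_le_integral => //.
  - by move=> x _; rewrite mule_ge0// lee_fin normal_pdf_ge0.
  - apply: emeasurable_funM.
      by apply: measurableT_comp => //; apply/measurable_EFinP; exact: measurable_funX.
    by apply/measurable_EFinP; exact: measurable_normal_pdf.
  - by apply/measurable_EFinP; apply: measurable_funM => //; exact: measurable_normal_pdf.
  - move=> x _; rewrite /= -EFinM lee_fin ger0_norm; last exact: exprn_even_ge0.
    exact: normal_fourth_moment_bound.
under eq_integral do rewrite EFinM.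
rewrite integralZl//; last exact: integrable_normal_pdf.
by rewrite integral_normal_pdf mule1 ltry.
Qed.

(** A vanishing second moment would concentrate the law at 0, whereas a law with a density gives a
    point measure 0. *)
Lemma normal_second_moment_neq0 : (\int[nu]_x (x ^+ 2)%:E != 0)%E.
Proof.
apply/eqP => I0.
have : nu.-negligible [set~ (0 : R)].
  have : ae_eq nu setT (fun x : R => (x ^+ 2)%:E) (cst 0).
    apply/ae_eq_integral_abs => //.
      by apply/measurable_EFinP; exact: measurable_funX.
    by under eq_integral do rewrite gee0_abs ?lee_fin ?sqr_ge0//.
  case=> A [mA A0 sA]; exists A; split => // x /eqP x0; apply: sA => /(_ I)[].
  by move/eqP; rewrite sqrf_eq0; exact/negP.
move=> neg0.
have nu0 : (nu [set~ 0%R] = 0)%E.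
  by apply: measure_negligible neg0; apply: measurableC.
have : (nu [set~ 0%R] = 1 - nu [set 0%R])%E.
  exact: probability_setC.
rewrite nu0 (_ : nu [set 0] = 0%E) ?/normal_prob ?integral_set1//.
by rewrite sube0 => /esym/eqP; rewrite onee_eq0.
Qed.

End normal_moments.

(** * Transfer of moments to normally distributed random variables *)

Section normal_law_moments.
Context {d : measure_display} {Omega : measurableType d} {R : realType}.
Variable P : probability Omega R.
Implicit Types X : Omega -> R.

Lemma normal_law_expectation X (g : R -> R) a :
  normal_law P X -> measurable_fun setT g ->
  has_expectation (@normal_prob R 0 1) g a ->
  has_expectation P (fun w => g (X w)) a.
Proof.
move=> [mX lX] mg [ig eg].
have mX' : measurable_fun setT (X : Omega -> measurableTypeR R) by exact: mX.
pose XR : {RV P >-> measurableTypeR R} :=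
  HB.pack X (isMeasurableFun.Build _ _ _ _ _ mX').
have lawE (A : set (measurableTypeR R)) : measurable A ->
    distribution P XR A = normal_prob 0 1 A.
  exact: lX.
have lawI (h : measurableTypeR R -> \bar R) : (\int[@normal_prob R 0 1]_x h x =
    \int[distribution P XR]_x h x)%E.
  by apply: eq_measure_integral => A mA _; exact/esym/lawE.
have igX : P.-integrable setT (EFin \o (fun w => g (X w))).
  apply/integrableP; split; first exact/measurable_EFinP/measurableT_comp.
  move/integrableP : ig => [_]; rewrite lawI ge0_integral_distribution//.
  by apply: measurableT_comp => //; exact/measurable_EFinP.
split => //; rewrite -eg lawI integral_distribution//; exact/measurable_EFinP.
Qed.

End normal_law_moments.

(** The moments are chosen before the probability space, so that they may enter the constant of the
    final rate. Their exact values do not matter, only the signs. *)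
Lemma normal_moments (R : realType) : exists M2 M4 : R,
  [/\ 0 < M2, 0 <= M4 & forall (d : measure_display) (Omega : measurableType d)
    (P : probability Omega R) (X : Omega -> R), normal_law P X ->
    [/\ has_expectation P X 0, has_expectation P (fun w => X w ^+ 2) M2 &
        has_expectation P (fun w => X w ^+ 4) M4]].
Proof.
have [M4 hM4] := integrable_has_expectation (@normal_fourth_moment R).
have h1M4 := has_expectationD (has_expectation_cst _ 1) hM4.
have sq0 (y : R) : 0 <= y ^+ 2 := sqr_ge0 y.
have [M2 hM2] : exists M2, has_expectation (@normal_prob R 0 1)
    (fun x => x ^+ 2) M2.
  apply: (has_expectation_dominated _ h1M4) => [|x]; first exact: measurable_funX.
  rewrite ger0_norm ?sqr_ge0//.
  have -> : x ^+ 4 = (x ^+ 2) ^+ 2 by rewrite -exprM.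
  have := sq0 x; have := sq0 (x ^+ 2 - 1); nra.
have [M1 hM1] : exists M1, has_expectation (@normal_prob R 0 1) id M1.
  apply: (has_expectation_dominated _
    (has_expectationD (has_expectation_cst _ 1) hM2)) => [//|x].
  by have := sq0 (x - 1); have := sq0 (x + 1); rewrite ler_norml /=; nra.
have mid : measurable_fun setT (id : R -> R) by [].
have mX n : measurable_fun setT (fun y : R => y ^+ n) by exact: measurable_funX.
(* The law is invariant under [x |-> - x], so the mean equals its own opposite. *)
have M10 : M1 = 0.
  have lawN : normal_law (@normal_prob R 0 1) (fun x : R => - x).
    by split; [exact: measurable_funN|exact: normal_prob_opp].
  have hN := normal_law_expectation lawN mid hM1.
  have := has_expectationD hM1 hN.
  move=> /(has_expectation_eq (Y := fun=> 0) (b := M1 + M1)).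
  move=> /(_ (fun x => addrN x) erefl) /has_expectation_unique.
  move=> /(_ _ (has_expectation_cst _ 0)); lra.
exists M2, M4; split=> [||d Omega P X lX].
- have M20 : 0 <= M2.
    exact: has_expectation_le (has_expectation_cst _ 0) hM2 (fun x => sq0 x).
  rewrite lt_neqAle M20 andbT eq_sym; have := normal_second_moment_neq0 R.
  by rewrite hM2.2 eqe.
- apply: has_expectation_le (has_expectation_cst _ 0) hM4 _ => x.
  exact: exprn_even_ge0.
- split.
  + by have := normal_law_expectation lX mid hM1; rewrite M10.
  + exact: normal_law_expectation lX (mX 2%N) hM2.
  + exact: normal_law_expectation lX (mX 4%N) hM4.
Qed.

(** * Smooth functions *)

Section smooth_functions.
Context {R : realType} {N m : nat}.
Variable f : 'M[R]_(N, m) -> R.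
Implicit Types x h : 'M[R]_(N, m).

Lemma coord_le_enorm x i j : `|x i j| <= enorm x.
Proof.
rewrite -sqrtr_sqr ler_sqrt; last first.
  by do 2!apply: sumr_ge0 => ? _; exact: sqr_ge0.
rewrite (bigD1 i)//= (bigD1 j)//= -addrA lerDl addr_ge0//.
  by apply: sumr_ge0 => ? _; exact: sqr_ge0.
by do 2!apply: sumr_ge0 => ? _; exact: sqr_ge0.
Qed.

Lemma enorm_delta i j : enorm (delta_mx i j : 'M[R]_(N, m)) = 1.
Proof.
rewrite /enorm (bigD1 i)//= (bigD1 j)//= !mxE !eqxx expr1n.
rewrite big1 ?addr0 => [|j' /negbTE jj']; last first.
  by rewrite mxE jj' andbF expr0n.
rewrite big1 ?addr0 ?sqrtr1// => i' /negbTE ii'.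
by rewrite big1// => j' _; rewrite mxE ii' expr0n.
Qed.

Lemma gradient_elipschitz L i j : esmooth L f ->
  elipschitz L (fun x => gradient f x i j).
Proof.
move=> [_ fL] x y; apply: le_trans (fL x y).
by have := coord_le_enorm (gradient f x - gradient f y) i j; rewrite !mxE.
Qed.

(** Difference quotients along the unit vector [delta_mx i j] are bounded by [L], and the bound
    passes to the limit. *)
Lemma gradient_le L x i j : elipschitz L f -> differentiable f x ->
  `|gradient f x i j| <= L.
Proof.
move=> fL df; rewrite mxE.
have cv : cvg ((fun t : R => t^-1 *: (f (t *: delta_mx i j + x) - f x)) @ 0^').
  exact: diff_derivable.
have quot (t : R) : t != 0 ->
    `|t^-1 *: (f (t *: delta_mx i j + x) - f x)| <= L.
  move=> t0; rewrite normrM normfV ler_pdivrMl ?normr_gt0//.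
  by apply: le_trans (fL _ _) _; rewrite addrK enormZ enorm_delta mulr1 mulrC.
rewrite ler_norml; apply/andP; split.
  apply: limr_ge => //; near=> t.
  suff /ler_normlP[] : `|t^-1 *: (f (t *: delta_mx i j + x) - f x)| <= L.
    by rewrite lerNl.
  apply: quot; near: t; exact: nbhs_dnbhs_neq.
apply: limr_le => //; near=> t; apply: ler_normlW.
apply: quot; near: t; exact: nbhs_dnbhs_neq.
Unshelve. all: by end_near.
Qed.

Lemma derive_gradient x h : differentiable f x ->
  'D_h f x = \sum_(i < N) \sum_(j < m) gradient f x i j * h i j.
Proof.
move=> df; rewrite deriveE// {1}(matrix_sum_delta h) linear_sum.
apply: eq_bigr => i _; rewrite linear_sum; apply: eq_bigr => j _.
by rewrite linearZ/= mxE deriveE// mulrC.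
Qed.

(** The mean value theorem along the segment turns the remainder into a pairing of a gradient
    difference with [h]. This costs a constant [L] where integration would give [L / 2]. *)
Lemma taylor L x h : 0 < L -> esmooth L f ->
  `|f (x + h) - f x - \sum_(i < N) \sum_(j < m) gradient f x i j * h i j| <=
  L * enorm h ^+ 2.
Proof.
move=> L0 [df fL].
pose phi (t : R) := f (x + t *: h).
have quotE (t : R) : (fun s : R => s^-1 *: (phi (s *: (1 : R) + t) - phi t)) =
    (fun s => s^-1 *: (f (s *: h + (x + t *: h)) - f (x + t *: h))).
  apply/funext => s; rewrite /phi; congr (_ *: (f _ - _)).
  by rewrite scalerDl -[s *: 1]/(s * 1) mulr1 addrCA.
have dphi (t : R) : is_derive t (1 : R) phi ('D_h f (x + t *: h)).
  apply: DeriveDef.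
    rewrite /derivable quotE; exact: diff_derivable.
  by rewrite /derive quotE.
have [|c c01] := @MVT R phi (fun t => 'D_h f (x + t *: h)) 0 1 ltr01.
  by apply: derivable_within_continuous => t _; case: (dphi t).
rewrite /phi scale1r scale0r addr0 subr0 mulr1 => ->.
rewrite !derive_gradient//.
pose D := gradient f (x + c *: h) - gradient f x.
have -> : \sum_(i < N) \sum_(j < m) gradient f (x + c *: h) i j * h i j -
    \sum_(i < N) \sum_(j < m) gradient f x i j * h i j =
    \sum_(i < N) \sum_(j < m) D i j * h i j.
  rewrite -sumrB; apply: eq_bigr => i _; rewrite -sumrB; apply: eq_bigr => j _.
  by rewrite /D !mxE mulrBl.
have DL : enorm D ^+ 2 <= L ^+ 2 * enorm h ^+ 2.
  rewrite -exprMn ler_pXn2r ?nnegrE ?enorm_ge0 ?mulr_ge0 ?enorm_ge0 ?(ltW L0)//.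
  apply: (le_trans (fL (x + c *: h) x)).
  rewrite ler_wpM2l ?(ltW L0)// (addrC x) addrK enormZ.
  rewrite ler_piMl ?enorm_ge0//; move: c01; rewrite in_itv/= => /andP[? ?].
  by rewrite ger0_norm ltW.
(* Weighted AM-GM in each coordinate replaces Cauchy-Schwarz; by smoothness both resulting terms are
   at most [L / 2 * enorm h ^+ 2]. *)
apply: (@le_trans _ _ (L^-1 / 2 * enorm D ^+ 2 + L / 2 * enorm h ^+ 2)).
  rewrite !enorm_sqr !mulr_sumr -big_split/=.
  apply: le_trans (ler_norm_sum _ _ _) _; apply: ler_sum => i _.
  rewrite !mulr_sumr -big_split/=.
  apply: le_trans (ler_norm_sum _ _ _) _; apply: ler_sum => j _.
  rewrite -subr_ge0 (_ : _ - _ = L^-1 / 2 * (`|D i j| - L * `|h i j|) ^+ 2).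
    by rewrite mulr_ge0 ?sqr_ge0// divr_ge0// invr_ge0 ltW.
  rewrite -(real_normK (num_real (D i j))) -(real_normK (num_real (h i j))) normrM.
  by field; exact: lt0r_neq0.
have : L^-1 / 2 * enorm D ^+ 2 <= L / 2 * enorm h ^+ 2.
  have -> : L / 2 * enorm h ^+ 2 = L^-1 / 2 * (L ^+ 2 * enorm h ^+ 2).
    by field; exact: lt0r_neq0.
  by rewrite ler_wpM2l// divr_ge0// invr_ge0 ltW.
lra.
Qed.

End smooth_functions.

(** * One step of the algorithm, pointwise *)

Section one_step.
Context {R : realType} {N m : nat}.
Variables (f : 'M[R]_(N, m) -> R) (L0 L alpha mu : R).
Hypothesis fL0 : elipschitz L0 f.
Hypothesis fL : esmooth L f.
Hypotheses (L_gt0 : 0 < L) (L0_gt0 : 0 < L0).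
Hypotheses (alpha_ge0 : 0 <= alpha) (mu_gt0 : 0 < mu).
Variables (x u : 'M[R]_(N, m)) (i0 : 'I_N) (z : 'I_m -> R) (q : 'I_N -> R).
Hypothesis u_block : forall i j, u i j = (i0 == i)%:R * z j.

(** Here [q] is the vector of memories and [z] the active block. [Y] is the directional derivative
    along [u], and [G2] is the upper bound used for the squared norm of the estimate. *)
Let S := \sum_(j < m) z j ^+ 2.
Let e i := f x - q i.
Let Y := \sum_(j < m) gradient f x i0 j * z j.
Let G2 := 2 * L0 ^+ 2 * S ^+ 2 + 2 / mu ^+ 2 * (e i0 ^+ 2 * S).
Let rate := (f (x + mu *: u) - q i0) / mu.
Let x' := x - (alpha * rate) *: u.

Lemma sum_block (F : 'I_N -> 'I_m -> R) :
  \sum_(i < N) \sum_(j < m) F i j * u i j = \sum_(j < m) F i0 j * z j.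
Proof.
rewrite (bigD1 i0)//= [X in _ + X]big1 ?addr0 => [|i /negbTE ii0].
  by apply: eq_bigr => j _; rewrite u_block eqxx mul1r.
by rewrite big1// => j _; rewrite u_block eq_sym ii0 mul0r mulr0.
Qed.

Lemma enorm_block : enorm u ^+ 2 = S.
Proof.
rewrite enorm_sqr; under eq_bigr do under eq_bigr do rewrite expr2.
rewrite sum_block; apply: eq_bigr => j _.
by rewrite u_block eqxx mul1r -expr2.
Qed.

Let S_ge0 : 0 <= S. Proof. by rewrite -enorm_block sqr_ge0. Qed.

Lemma query_error_le : (f (x + mu *: u) - f x) ^+ 2 <= L0 ^+ 2 * mu ^+ 2 * S.
Proof.
rewrite -(real_normK (num_real _)) -enorm_block -!exprMn.
rewrite ler_pXn2r ?nnegrE ?normr_ge0// ?mulr_ge0 ?enorm_ge0 ?(ltW L0_gt0)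
  ?(ltW mu_gt0)//.
apply: le_trans (fL0 _ _) _.
by rewrite addrC addKr enormZ gtr0_norm// mulrA.
Qed.

(** The numerator of [rate] is the stale error plus the change of [f] from [x] to the query point;
    [(a + b) ^+ 2 <= 2 * a ^+ 2 + 2 * b ^+ 2] separates them. *)
Lemma estimate_sqr_le : rate ^+ 2 * S <= G2.
Proof.
have := query_error_le.
set b := f _ - f x; pose a := e i0 => b_le.
have rateE : rate = (a + b) / mu by rewrite /rate /a /b /e; congr (_ / _); ring.
have mu2 : 0 < mu ^+ 2 by rewrite exprn_gt0.
rewrite rateE expr_div_n /G2 -/a.
have -> : (a + b) ^+ 2 / mu ^+ 2 * S = (a + b) ^+ 2 * S / mu ^+ 2 by ring.
rewrite ler_pdivrMr//.
have -> : (2 * L0 ^+ 2 * S ^+ 2 + 2 / mu ^+ 2 * (a ^+ 2 * S)) * mu ^+ 2 =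
    2 * (L0 ^+ 2 * mu ^+ 2 * S) * S + 2 * a ^+ 2 * S.
  by field; exact: lt0r_neq0.
have : b ^+ 2 * S <= L0 ^+ 2 * mu ^+ 2 * S * S by rewrite ler_wpM2r.
have : 0 <= (a - b) ^+ 2 * S by rewrite mulr_ge0 ?sqr_ge0.
nra.
Qed.

Lemma step_sqr_le : enorm (x' - x) ^+ 2 <= alpha ^+ 2 * G2.
Proof.
rewrite /x' [_ - x]addrC addKr -scaleNr enormZ exprMn real_normK ?num_real//.
rewrite sqrrN exprMn enorm_block -mulrA ler_wpM2l ?sqr_ge0//.
exact: estimate_sqr_le.
Qed.

(** Young's inequality separates the move of the iterate from the update of the memory. The
    parameter [r] is left free; it will be the least activation probability, so that
    [(1 + r) * (1 - r) < 1]. *)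
Lemma memory_error_step (r : R) i : 0 < r ->
  (f x' - (if i0 == i then f (x + mu *: u) else q i)) ^+ 2 <=
  (1 + r^-1) * (L0 ^+ 2 * alpha ^+ 2 * G2) +
  (1 + r) * ((i0 == i)%:R * (L0 ^+ 2 * mu ^+ 2 * S)
             + (1 - (i0 == i)%:R) * e i ^+ 2).
Proof.
move=> r0.
pose b := if i0 == i then f x - f (x + mu *: u) else e i.
pose a := f x' - f x.
have -> : f x' - (if i0 == i then f (x + mu *: u) else q i) = a + b.
  by rewrite /a /b /e; case: (i0 == i); ring.
have a_le : a ^+ 2 <= L0 ^+ 2 * alpha ^+ 2 * G2.
  rewrite -mulrA; apply: (@le_trans _ _ (L0 ^+ 2 * enorm (x' - x) ^+ 2)).
    rewrite -(real_normK (num_real _)) -exprMn.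
    rewrite ler_pXn2r ?nnegrE ?normr_ge0// ?mulr_ge0 ?enorm_ge0 ?(ltW L0_gt0)//.
    exact: fL0.
  by rewrite ler_wpM2l ?sqr_ge0//; exact: step_sqr_le.
have b_le : b ^+ 2 <= (i0 == i)%:R * (L0 ^+ 2 * mu ^+ 2 * S) +
    (1 - (i0 == i)%:R) * e i ^+ 2.
  rewrite /b; case: (i0 == i).
    by rewrite mul1r subrr mul0r addr0 -sqrrN opprB; exact: query_error_le.
  by rewrite mul0r add0r subr0 mul1r.
apply: (@le_trans _ _ ((1 + r^-1) * a ^+ 2 + (1 + r) * b ^+ 2)).
  rewrite -subr_ge0 (_ : _ - _ = r^-1 * (a - r * b) ^+ 2).
    by rewrite mulr_ge0 ?sqr_ge0// invr_ge0 ltW.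
  by field; exact: lt0r_neq0.
have r1 : 0 < r^-1 by rewrite invr_gt0.
by apply: lerD; rewrite ler_wpM2l// addr_ge0// ltW.
Qed.

(** One Taylor expansion is taken at the new iterate and one at the query point. The product of
    stale error and [Y] is kept exactly, since it has mean zero, and half of [Y ^+ 2] is given up to
    absorb the remainder. *)
Lemma descent_step :
  f x' <= f x - alpha / 2 * Y ^+ 2 + alpha * L ^+ 2 * mu ^+ 2 / 2 * S ^+ 2
          - alpha / mu * (e i0 * Y) + L * alpha ^+ 2 * G2.
Proof.
have := taylor x (- ((alpha * rate) *: u)) L_gt0 fL.
rewrite -/x' => /ler_normlW.
have -> : \sum_(i < N) \sum_(j < m) gradient f x i j *
    (- ((alpha * rate) *: u)) i j = - (alpha * rate) * Y.
  rewrite /Y -(sum_block (fun i j => gradient f x i j)) mulr_sumr.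
  apply: eq_bigr => i _; rewrite mulr_sumr; apply: eq_bigr => j _.
  by rewrite !mxE; ring.
have := step_sqr_le; rewrite /x' [_ - x]addrC addKr.
move=> /(ler_wpM2l (ltW L_gt0)) sq le1.
have := taylor x (mu *: u) L_gt0 fL.
have -> : \sum_(i < N) \sum_(j < m) gradient f x i j * (mu *: u) i j = mu * Y.
  rewrite /Y -(sum_block (fun i j => gradient f x i j)) mulr_sumr.
  apply: eq_bigr => i _; rewrite mulr_sumr; apply: eq_bigr => j _.
  by rewrite !mxE; ring.
rewrite enormZ exprMn real_normK ?num_real// enorm_block.
set rem := f (x + mu *: u) - f x - mu * Y => rem_le.
(* The estimate splits into the true derivative, the stale error and a smoothing error. *)
have rateE : rate = Y + e i0 / mu + rem / mu.
  by rewrite /rate /e /rem; field; exact: lt0r_neq0.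
(* AM-GM on the Taylor remainder of the finite difference. *)
have key : - (rem / mu * Y) <= Y ^+ 2 / 2 + L ^+ 2 * mu ^+ 2 / 2 * S ^+ 2.
  set t := rem / mu.
  have t_le : t ^+ 2 <= (L * mu * S) ^+ 2.
    rewrite -(real_normK (num_real t)) ler_pXn2r ?nnegrE//; last first.
      by rewrite !mulr_ge0// ltW.
    rewrite /t normrM normfV (gtr0_norm mu_gt0) ler_pdivrMr//.
    by apply: le_trans rem_le _; rewrite le_eqVlt; apply/orP; left; apply/eqP; ring.
  have amgm (y b : R) : t ^+ 2 <= b -> - (t * y) <= y ^+ 2 / 2 + b / 2.
    by have := sqr_ge0 (y + t); move: (t) => t'; nra.
  rewrite [X in _ <= _ + X](_ : _ = (L * mu * S) ^+ 2 / 2); last by ring.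
  exact: amgm.
have : - (alpha * rate) * Y <= alpha * (- (Y ^+ 2) - e i0 * Y / mu +
    (Y ^+ 2 / 2 + L ^+ 2 * mu ^+ 2 / 2 * S ^+ 2)).
  rewrite (_ : - (alpha * rate) * Y = alpha * - (rate * Y)); last by ring.
  rewrite ler_wpM2l// rateE.
  have -> : - ((Y + e i0 / mu + rem / mu) * Y) =
    - Y ^+ 2 - e i0 * Y / mu - rem / mu * Y by ring.
  by rewrite lerD2l.
have -> : alpha * (- (Y ^+ 2) - e i0 * Y / mu +
    (Y ^+ 2 / 2 + L ^+ 2 * mu ^+ 2 / 2 * S ^+ 2)) =
  - (alpha / 2 * Y ^+ 2) + alpha * L ^+ 2 * mu ^+ 2 / 2 * S ^+ 2
  - alpha / mu * (e i0 * Y) by field; exact: lt0r_neq0.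
move: le1 sq; rewrite mulrA; lra.
Qed.

End one_step.

(** * One step of the algorithm, in expectation *)

Definition mean (d : measure_display) (Omega : measurableType d) (R : realType)
    (P : probability Omega R) (X : Omega -> R) : R :=
  fine (\int[P]_w (X w)%:E)%E.

Lemma has_expectation_mean (d : measure_display) (Omega : measurableType d)
    (R : realType) (P : probability Omega R) (X : Omega -> R) a :
  has_expectation P X a -> has_expectation P X (mean P X).
Proof. by case=> iX eX; split=> //; rewrite /mean eX. Qed.

(** Apply [2 * a i * a j <= a i ^+ 2 + a j ^+ 2] to every pair of indices and sum. *)
Lemma sqr_sum_le (R : realFieldType) (m : nat) (a : 'I_m -> R) :
  (\sum_(j < m) a j) ^+ 2 <= m%:R * \sum_(j < m) a j ^+ 2.
Proof.
have -> : m%:R * \sum_(j < m) a j ^+ 2 =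
    \sum_(i < m) \sum_(j < m) (a i ^+ 2 + a j ^+ 2) / 2.
  under [RHS]eq_bigr do rewrite -mulr_suml big_split/= sumr_const card_ord.
  rewrite -mulr_suml big_split/= sumr_const card_ord sumrMnl mulr_natl.
  by rewrite -mulr2n -[X in X / 2]mulr_natr mulfK// pnatr_eq0.
rewrite expr2 mulr_suml; apply: ler_sum => i _; rewrite mulr_sumr.
apply: ler_sum => j _; have := sqr_ge0 (a i - a j); nra.
Qed.

Section expected_step.
Context {d : measure_display} {Omega : measurableType d} {R : realType}.
Context {N m T : nat} {P : probability Omega R} {p : 'I_N -> R}.
Context {s : nat -> Omega -> 'I_N} {u : nat -> Omega -> 'M[R]_(N, m)}.
Context {v : 'I_N -> Omega -> 'M[R]_(N, m)} {tau : Omega -> 'I_T}.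
Hypothesis model : sampling_model P p s u v tau.
Variables (f : 'M[R]_(N, m) -> R) (L0 L alpha mu : R) (x0 : 'M[R]_(N, m)).
Variable x : nat -> Omega -> 'M[R]_(N, m).
Hypothesis run : forall w, residual_feedback_run f alpha mu x0
  (s ^~ w) (u ^~ w) (v ^~ w) (x ^~ w).
Hypothesis fL0 : elipschitz L0 f.
Hypothesis fL : esmooth L f.
Hypotheses (L_gt0 : 0 < L) (L0_gt0 : 0 < L0).
Hypotheses (alpha_ge0 : 0 <= alpha) (mu_gt0 : 0 < mu).
Variables (M2 M4 : R).
Hypothesis moments : forall X : Omega -> R, normal_law P X ->
  [/\ has_expectation P X 0, has_expectation P (fun w => X w ^+ 2) M2 &
      has_expectation P (fun w => X w ^+ 4) M4].

Let z k w (j : 'I_m) : R := active_block s u k w ord0 j.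
Let mem k i w : R := memory f mu x0 (s ^~ w) (u ^~ w) (v ^~ w) (x ^~ w) k i.

Definition block_sqr k w : R := \sum_(j < m) z k w j ^+ 2.
Definition stale_error k i w : R := f (x k w) - mem k i w.
Definition gradient_sqr k w : R := enorm (gradient f (x k w)) ^+ 2.

Let S := block_sqr.
Let e := stale_error.
Let g k w (i : 'I_N) (j : 'I_m) : R := gradient f (x k w) i j.
Let Y k w : R := \sum_(j < m) g k w (s k w) j * z k w j.

Lemma block_moment k j j' :
  has_expectation P (fun w => z k w j * z k w j') ((j == j')%:R * M2).
Proof.
have [zj zj2 _] := moments (active_block_normal model k j).
have [zj' _ _] := moments (active_block_normal model k j').
case: eqVneq => [<-|jj'].
  by apply: has_expectation_eq zj2 => [w|]; rewrite ?expr2 ?mul1r.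
have := has_expectationM zj zj' (active_block_independent model k jj').
by apply: has_expectation_eq => //; rewrite !mul0r.
Qed.

Lemma block_sqr_expectation k : has_expectation P (S k) (m%:R * M2).
Proof.
have := has_expectation_sum (index_enum 'I_m) (fun j => block_moment k j j).
apply: has_expectation_eq => [w|]; first by apply: eq_bigr => j _; rewrite expr2.
under eq_bigr do rewrite eqxx mul1r.
by rewrite sumr_const card_ord mulr_natl.
Qed.

Let block_measurable k j :
  measurable_fun (setT : set (block_generated (s:=s) (u:=u) k)) (fun w => z k w j).
Proof. exact: block_generated_coord. Qed.

Let S_measurable k :
  measurable_fun (setT : set (block_generated (s:=s) (u:=u) k)) (S k).
Proof.
by apply: measurable_sum => j; apply: measurable_funX; exact: block_measurable.
Qed.

(** Cauchy-Schwarz bounds [S k w ^+ 2] by fourth powers of the coordinates, so mixed moments need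
    not be computed. *)
Lemma block_sqr2_expectation k : exists Q, [/\ 0 <= Q, Q <= m%:R ^+ 2 * M4 &
  has_expectation P (fun w => S k w ^+ 2) Q].
Proof.
have z4 j : has_expectation P (fun w => z k w j ^+ 4) M4.
  by have [] := moments (active_block_normal model k j).
have h4 : has_expectation P (fun w => m%:R * \sum_(j < m) z k w j ^+ 4)
    (m%:R * (m%:R * M4)).
  apply: has_expectationZ; have := has_expectation_sum (index_enum 'I_m) z4.
  by apply: has_expectation_eq => //; rewrite sumr_const card_ord mulr_natl.
have S4 w : S k w ^+ 2 <= m%:R * \sum_(j < m) z k w j ^+ 4.
  apply: le_trans (sqr_sum_le _) _; rewrite ler_wpM2l//.
  by apply: ler_sum => j _; rewrite -exprM.
have mS : measurable_fun setT (S k).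
  exact: has_expectation_measurable (block_sqr_expectation k).
have [w|Q hQ] := has_expectation_dominated (measurable_funX 2 mS) h4.
  by rewrite ger0_norm ?sqr_ge0.
exists Q; split=> //.
  by apply: has_expectation_le (has_expectation_cst P 0) hQ _ => w; exact: sqr_ge0.
by rewrite expr2 -mulrA; exact: has_expectation_le hQ h4 S4.
Qed.

Let x_measurable k i j : measurable_fun
  (setT : set (generated (s:=s) (u:=u) (v:=v) (tau:=tau) (past k)))
  (fun w => x k w i j).
Proof. by have [+ _] := measurable_run_past model k fL0 run; apply. Qed.

Let fx_measurable k : measurable_fun
  (setT : set (generated (s:=s) (u:=u) (v:=v) (tau:=tau) (past k)))
  (fun w => f (x k w)).
Proof.
by apply: (elipschitz_measurable fL0) => i j; exact: x_measurable.
Qed.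

Lemma stale_error_measurable k i : measurable_fun
  (setT : set (generated (s:=s) (u:=u) (v:=v) (tau:=tau) (past k))) (e k i).
Proof.
apply: measurable_funB; first exact: fx_measurable.
by have [_ +] := measurable_run_past model k fL0 run; apply.
Qed.

Let g_measurable k i j : measurable_fun
  (setT : set (generated (s:=s) (u:=u) (v:=v) (tau:=tau) (past k)))
  (fun w => g k w i j).
Proof.
apply: (elipschitz_measurable (gradient_elipschitz i j fL)) => i' j'.
exact: x_measurable.
Qed.

Lemma gradient_sqr_measurable k : measurable_fun
  (setT : set (generated (s:=s) (u:=u) (v:=v) (tau:=tau) (past k)))
  (gradient_sqr k).
Proof.
rewrite /gradient_sqr (_ : (fun w => _) = fun w =>
  \sum_(i < N) \sum_(j < m) g k w i j ^+ 2); last first.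
  by apply/funext => w; rewrite enorm_sqr.
apply: measurable_sum => i; apply: measurable_sum => j.
by apply: measurable_funX; exact: g_measurable.
Qed.

Let g_le k w i j : `|g k w i j| <= L0.
Proof. by apply: gradient_le => //; have [+ _] := fL; apply. Qed.

Lemma gradient_sqr_le k w : gradient_sqr k w <= (N * m)%:R * L0 ^+ 2.
Proof. by apply: enorm_le_sup => [|i j]; [exact: ltW|exact: g_le]. Qed.

Let ggE k i j j' : has_expectation P (fun w => g k w i j * g k w i j')
  (mean P (fun w => g k w i j * g k w i j')).
Proof.
have [|w|a] := has_expectation_dominated (P := P) _
    (has_expectation_cst P (L0 * L0)) (X := fun w => g k w i j * g k w i j').
- apply: (measurable_generatedW model (D := past k)).
  by apply: measurable_funM; exact: g_measurable.
- by rewrite normrM ler_pM.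
- exact: has_expectation_mean.
Qed.

Lemma gradient_sqr_expectation k :
  has_expectation P (gradient_sqr k) (mean P (gradient_sqr k)).
Proof.
have := has_expectation_sum (index_enum 'I_N) (fun i =>
  has_expectation_sum (index_enum 'I_m) (fun j => ggE k i j j)).
move=> h; apply: (has_expectation_mean (a := \sum_(i < N) \sum_(j < m)
  mean P (fun w => g k w i j * g k w i j))).
apply: has_expectation_eq h => // w; rewrite /gradient_sqr enorm_sqr.
by apply: eq_bigr => i _; apply: eq_bigr => j _; rewrite expr2.
Qed.

(** Replaces evaluation at the random agent by a sum over agents, to each term of which
    [has_expectation_step] applies. *)
Let select (F : 'I_N -> R) (i : 'I_N) :
  \sum_(i' < N) F i' * (i == i')%:R = F i.
Proof.
rewrite (bigD1 i)//= eqxx mulr1 big1 ?addr0// => i' /negbTE.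
by rewrite eq_sym => ->; rewrite mulr0.
Qed.

(** Expand the square: the coordinates of the block are uncorrelated and independent of the
    gradient, so only diagonal terms survive. *)
Lemma directional_sqr_expectation k : has_expectation P (fun w => Y k w ^+ 2)
  (\sum_(i < N) p i * (M2 * \sum_(j < m) mean P (fun w => g k w i j * g k w i j))).
Proof.
have h i j j' : has_expectation P
    (fun w => g k w i j * g k w i j' * (s k w == i)%:R * (z k w j * z k w j'))
    (mean P (fun w => g k w i j * g k w i j') * p i * ((j == j')%:R * M2)).
  apply: (has_expectation_step model).
  - by apply: measurable_funM; exact: g_measurable.
  - by apply: measurable_funM; exact: block_measurable.
  - exact: ggE.
  - exact: block_moment.
have := has_expectation_sum (index_enum 'I_N) (fun i =>
  has_expectation_sum (index_enum 'I_m) (fun j =>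
  has_expectation_sum (index_enum 'I_m) (h i j))).
apply: has_expectation_eq => [w|].
  rewrite -(select (fun i => (\sum_(j < m) g k w i j * z k w j) ^+ 2) (s k w)).
  apply: eq_bigr => i _; rewrite expr2 mulr_suml mulr_suml; apply: eq_bigr => j _.
  rewrite mulr_sumr mulr_suml; apply: eq_bigr => j' _ /=; ring.
apply: eq_bigr => i _; rewrite !mulr_sumr; apply: eq_bigr => j _.
rewrite (bigD1 j)//= eqxx big1 ?addr0 => [|j' /negbTE].
  by rewrite mul1r; ring.
by rewrite eq_sym => ->; rewrite mul0r mulr0.
Qed.

(** * Expected one-step bounds from given moments at step k *)

Section given_past.
Variables (k : nat) (V : 'I_N -> R) (Fk : R).
Hypothesis eV : forall i, has_expectation P (fun w => e k i w ^+ 2) (V i).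
Hypothesis fF : has_expectation P (fun w => f (x k w)) Fk.

Let Q := mean P (fun w => S k w ^+ 2).

Let Q_expectation : has_expectation P (fun w => S k w ^+ 2) Q.
Proof.
by have [Q' [_ _]] := block_sqr2_expectation k; exact: has_expectation_mean.
Qed.

Let e2_measurable i : measurable_fun
  (setT : set (generated (s:=s) (u:=u) (v:=v) (tau:=tau) (past k)))
  (fun w => e k i w ^+ 2).
Proof. by apply: measurable_funX; exact: stale_error_measurable. Qed.

(** Stale error and gradient are determined by the past, while each coordinate of the block is
    centred and independent of it; this removes the effect of the delay on the descent direction. *)
Let cross_expectation :
  has_expectation P (fun w => e k (s k w) w * Y k w) 0.
Proof.
have hZ j : has_expectation P (fun w => z k w j) 0.
  by have [] := moments (active_block_normal model k j).
(* Integrable because the gradient entries are bounded by [L0] and [|e| <= 1 + e ^+ 2]. *)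
have eg i j : exists a, has_expectation P (fun w => e k i w * g k w i j) a.
  apply: (has_expectation_dominated _
    (has_expectationZ L0 (has_expectationD (has_expectation_cst P 1) (eV i)))).
    apply: (measurable_generatedW model (D := past k)).
    by apply: measurable_funM; [exact: stale_error_measurable|exact: g_measurable].
  move=> w; rewrite normrM mulrC ler_pM//.
  by rewrite ler_norml; have := sqr_ge0 (e k i w - 1);
    have := sqr_ge0 (e k i w + 1); nra.
have h0 i j : has_expectation P
    (fun w => e k i w * g k w i j * (s k w == i)%:R * z k w j) 0.
  have [a ha] := eg i j; rewrite -(mulr0 (a * p i)).
  apply: (has_expectation_step model i _ _ ha (hZ j)); last exact: block_measurable.
  by apply: measurable_funM; [exact: stale_error_measurable|exact: g_measurable].
have := has_expectation_sum (index_enum 'I_N) (fun i =>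
  has_expectation_sum (index_enum 'I_m) (h0 i)).
apply: has_expectation_eq => [w|]; last by rewrite big1// => i _; rewrite big1.
rewrite -(select (fun i => e k i w * \sum_(j < m) g k w i j * z k w j) (s k w)).
apply: eq_bigr => i _; rewrite mulr_sumr mulr_suml; apply: eq_bigr => j _; ring.
Qed.

(** The random version of the pointwise bound [G2]; it dominates the squared norm of the gradient
    estimate. *)
Definition estimate_sqr w : R :=
  2 * L0 ^+ 2 * S k w ^+ 2 + 2 / mu ^+ 2 * (e k (s k w) w ^+ 2 * S k w).

Definition estimate_sqr_mean : R :=
  2 * L0 ^+ 2 * Q + 2 / mu ^+ 2 * (\sum_(i < N) V i * p i * (m%:R * M2)).

Lemma estimate_sqr_expectation :
  has_expectation P estimate_sqr estimate_sqr_mean.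
Proof.
apply: has_expectationD; first exact: has_expectationZ.
apply: has_expectationZ.
have h i : has_expectation P (fun w => e k i w ^+ 2 * (s k w == i)%:R * S k w)
    (V i * p i * (m%:R * M2)).
  by apply: (has_expectation_step model) => //; exact: block_sqr_expectation.
have := has_expectation_sum (index_enum 'I_N) h.
apply: has_expectation_eq => // w.
by rewrite -(select (fun i => e k i w ^+ 2 * S k w) (s k w));
  apply: eq_bigr => i _; ring.
Qed.

Let step_eq w : x k.+1 w =
  x k w - (alpha * ((f (x k w + mu *: u k w) - mem k (s k w) w) / mu)) *: u k w.
Proof. exact: residual_feedback_step (run w). Qed.

Let u_block w i j : u k w i j = (s k w == i)%:R * z k w j.
Proof. exact: directionE model _ _ _ _. Qed.

Lemma stale_error_step r i : 0 < r -> exists2 V',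
  has_expectation P (fun w => e k.+1 i w ^+ 2) V' &
  V' <= (1 + r^-1) * (L0 ^+ 2 * alpha ^+ 2 * estimate_sqr_mean) +
        (1 + r) * (p i * (L0 ^+ 2 * mu ^+ 2 * (m%:R * M2)) + (1 - p i) * V i).
Proof.
move=> r0.
(* The factors 1 give the terms the shape past times activation times block required by
   [has_expectation_step]. *)
have hB : has_expectation P
    (fun w => (1 + r^-1) * (L0 ^+ 2 * alpha ^+ 2 * estimate_sqr w) +
    (1 + r) * (L0 ^+ 2 * mu ^+ 2 * (1 * (s k w == i)%:R * S k w) +
      (e k i w ^+ 2 - e k i w ^+ 2 * (s k w == i)%:R * 1)))
    ((1 + r^-1) * (L0 ^+ 2 * alpha ^+ 2 * estimate_sqr_mean) +
    (1 + r) * (L0 ^+ 2 * mu ^+ 2 * (1 * p i * (m%:R * M2)) +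
      (V i - V i * p i * 1))).
  apply: has_expectationD.
    by do 2!apply: has_expectationZ; exact: estimate_sqr_expectation.
  apply: has_expectationZ; apply: has_expectationD.
    apply: has_expectationZ.
    by apply: (has_expectation_step model i _ _ (has_expectation_cst P 1)
      (block_sqr_expectation k)).
  apply: has_expectationB => //.
  by apply: (has_expectation_step model i _ _ (eV i) (has_expectation_cst P 1)).
have ub w : e k.+1 i w ^+ 2 <=
    (1 + r^-1) * (L0 ^+ 2 * alpha ^+ 2 * estimate_sqr w) +
    (1 + r) * (L0 ^+ 2 * mu ^+ 2 * (1 * (s k w == i)%:R * S k w) +
      (e k i w ^+ 2 - e k i w ^+ 2 * (s k w == i)%:R * 1)).
  have := memory_error_step alpha fL0 L0_gt0 mu_gt0 (x k w)
    (fun i => mem k i w) (fun i j => u_block w i j) i r0.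
  rewrite -step_eq => /le_trans; apply.
  rewrite le_eqVlt; apply/orP; left; apply/eqP.
  by rewrite /estimate_sqr /e /stale_error /S /block_sqr; ring.
have [|w|V' hV'] := has_expectation_dominated (P := P)
    (X := fun w => e k.+1 i w ^+ 2) _ hB.
- apply: (measurable_generatedW model (D := past k.+1)).
  by apply: measurable_funX; exact: stale_error_measurable.
- by rewrite ger0_norm ?sqr_ge0.
exists V' => //; apply: le_trans (has_expectation_le hV' hB ub) _.
by rewrite le_eqVlt; apply/orP; left; apply/eqP; ring.
Qed.

Lemma objective_step q : 0 < M2 -> (forall i, q <= p i) -> exists2 F',
  has_expectation P (fun w => f (x k.+1 w)) F' &
  F' <= Fk - alpha / 2 * (q * M2 * mean P (gradient_sqr k))
        + alpha * L ^+ 2 * mu ^+ 2 / 2 * Q + L * alpha ^+ 2 * estimate_sqr_mean.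
Proof.
move=> M20 qp.
have hB := has_expectationD (has_expectationB (has_expectationD (has_expectationB fF
  (has_expectationZ (alpha / 2) (directional_sqr_expectation k)))
  (has_expectationZ (alpha * L ^+ 2 * mu ^+ 2 / 2) Q_expectation))
  (has_expectationZ (alpha / mu) cross_expectation))
  (has_expectationZ (L * alpha ^+ 2) estimate_sqr_expectation).
have ub w := descent_step fL0 fL L_gt0 L0_gt0 alpha_ge0 mu_gt0
    (x k w) (fun i => mem k i w) (fun i j => u_block w i j).
(* Integrability of the new objective value comes from its increment, at most
   [L0 / 2 * (1 + |x k.+1 - x k| ^+ 2)]. *)
have [|w|c hc] := has_expectation_dominated (P := P)
    (X := fun w => f (x k.+1 w) - f (x k w)) _
    (has_expectationZ (L0 / 2) (has_expectationD (has_expectation_cst P 1)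
      (has_expectationZ (alpha ^+ 2) estimate_sqr_expectation))).
- apply: measurable_funB.
    by apply: (measurable_generatedW model (D := past k.+1)); exact: fx_measurable.
  by apply: (measurable_generatedW model (D := past k)); exact: fx_measurable.
- apply: le_trans (fL0 _ _) _; rewrite -mulrA ler_wpM2l ?(ltW L0_gt0)//.
  have := step_sqr_le alpha fL0 L0_gt0 mu_gt0 (x k w)
    (fun i => mem k i w) (fun i j => u_block w i j).
  rewrite -step_eq -/(estimate_sqr w).
  by have := sqr_ge0 (enorm (x k.+1 w - x k w) - 1); nra.
have hF' : has_expectation P (fun w => f (x k.+1 w)) (Fk + c).
  by apply: has_expectation_eq (has_expectationD fF hc) => // w; rewrite addrC subrK.
exists (Fk + c) => //.
have /has_expectation_le /(_ hB) := hF'; rewrite mulr0 subr0 => /(_ _)/le_trans.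
apply.
  by move=> w; have := ub w; rewrite -step_eq.
rewrite 2!lerD2r lerD2l lerN2 ler_wpM2l ?divr_ge0//.
have mg0 i j : 0 <= mean P (fun w => g k w i j * g k w i j).
  apply: has_expectation_le (has_expectation_cst P 0) (ggE k i j j) _ => w.
  by rewrite -expr2 sqr_ge0.
have -> : mean P (gradient_sqr k) =
    \sum_(i < N) \sum_(j < m) mean P (fun w => g k w i j * g k w i j).
  apply: has_expectation_unique (gradient_sqr_expectation k) _.
  have := has_expectation_sum (index_enum 'I_N) (fun i =>
    has_expectation_sum (index_enum 'I_m) (fun j => ggE k i j j)).
  apply: has_expectation_eq => // w; rewrite /gradient_sqr enorm_sqr.
  by apply: eq_bigr => i _; apply: eq_bigr => j _; rewrite expr2.
rewrite -mulrA !mulr_sumr; apply: ler_sum => i _.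
by rewrite ler_wpM2r// mulr_ge0 ?(ltW M20)// sumr_ge0.
Qed.

End given_past.

End expected_step.

(** * The recursion for the stale errors *)

Section recursion.
Context {R : realType} {N : nat}.
Variables (p : 'I_N -> R) (q : R).
Hypotheses (q_gt0 : 0 < q) (qp : forall i, q <= p i).
Hypothesis p_sum : \sum_(i < N) p i = 1.

Lemma card_mul_min_le1 : N%:R * q <= 1.
Proof.
have -> : N%:R * q = \sum_(i < N) q by rewrite sumr_const card_ord mulr_natl.
by rewrite -p_sum; exact: ler_sum.
Qed.

Lemma weight_le1 i : p i <= 1.
Proof.
rewrite -p_sum (bigD1 i)//= lerDl sumr_ge0// => j _.
exact: le_trans (ltW q_gt0) (qp j).
Qed.

(** The fixed point [K] of [K = (1 - q ^+ 2 / 2) * K + (1 + 2 * M2)], the contraction satisfied by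
    the stale errors in units of [noise]. *)
Definition stale_constant (M2 : R) : R := 2 * (1 + 2 * M2) / q ^+ 2.

Definition estimate_constant (M2 M4 : R) : R :=
  2 * M4 + 2 * M2 * stale_constant M2.

(** Above this threshold both [M2 / (q * t) <= q ^+ 2 / 2] and [M4 / (q * t) <= 1] hold. *)
Definition burn_in (M2 M4 : R) : R := 2 * M2 / q ^+ 3 + M4 / q.

Variables (m : nat) (M2 M4 L0 alpha mu t : R).
Hypotheses (m_gt0 : (0 < m)%N) (M2_gt0 : 0 < M2) (M4_ge0 : 0 <= M4).
Hypotheses (L0_gt0 : 0 < L0) (mu_gt0 : 0 < mu).
(* [t] is the number of iterations. *)
Hypothesis t_ge : burn_in M2 M4 <= t.
(** This balance between [alpha] and [mu] makes the feedback of the estimate on the stale errors of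
    order [1 / t]. *)
Hypothesis stepsize : L0 ^+ 2 * alpha ^+ 2 * (4 * m%:R * t) = q * mu ^+ 2.

Let noise := L0 ^+ 2 * mu ^+ 2 * m%:R.

Lemma estimate_bound (V : 'I_N -> R) Q : (forall i, 0 <= V i) ->
  \sum_(i < N) V i <= stale_constant M2 * noise -> Q <= m%:R ^+ 2 * M4 ->
  2 * L0 ^+ 2 * Q + 2 / mu ^+ 2 * (\sum_(i < N) V i * p i * (m%:R * M2)) <=
  L0 ^+ 2 * m%:R ^+ 2 * estimate_constant M2 M4.
Proof.
move=> V0 VK QM.
have mm : 0 < m%:R :> R by rewrite ltr0n.
have mu2 : 0 < mu ^+ 2 by rewrite exprn_gt0.
have -> : L0 ^+ 2 * m%:R ^+ 2 * estimate_constant M2 M4 =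
    2 * L0 ^+ 2 * (m%:R ^+ 2 * M4) +
    2 / mu ^+ 2 * (stale_constant M2 * noise * (m%:R * M2)).
  by rewrite /estimate_constant /noise; field; exact: lt0r_neq0.
apply: lerD; first by rewrite ler_wpM2l// mulr_ge0 ?sqr_ge0.
rewrite ler_wpM2l ?divr_ge0 ?(ltW mu2)// -mulr_suml.
rewrite ler_wpM2r ?mulr_ge0 ?(ltW M2_gt0)//.
apply: le_trans VK; apply: ler_sum => i _.
by rewrite ler_piMr// weight_le1.
Qed.

(** Young's parameter [q] gives the factor [(1 + q) * (1 - q) = 1 - q ^+ 2] on the old errors. The
    move of the iterate adds back at most [q ^+ 2 / 2], which leaves a contraction whose fixed point
    is [stale_constant]. *)
Lemma stale_recursion (V V' : 'I_N -> R) Q : (forall i, 0 <= V i) ->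
  \sum_(i < N) V i <= stale_constant M2 * noise -> 0 <= Q <= m%:R ^+ 2 * M4 ->
  (forall i, V' i <= (1 + q^-1) * (L0 ^+ 2 * alpha ^+ 2 *
      (2 * L0 ^+ 2 * Q + 2 / mu ^+ 2 * (\sum_(i < N) V i * p i * (m%:R * M2)))) +
     (1 + q) * (p i * (L0 ^+ 2 * mu ^+ 2 * (m%:R * M2)) + (1 - p i) * V i)) ->
  \sum_(i < N) V' i <= stale_constant M2 * noise.
Proof.
move=> V0 VK /andP[Q0 QM] step.
have mm : 0 < m%:R :> R by rewrite ltr0n.
have mu2 : 0 < mu ^+ 2 by rewrite exprn_gt0.
have L02 : 0 < L0 ^+ 2 by rewrite exprn_gt0.
set W := \sum_(i < N) V i in VK *.
have W0 : 0 <= W by rewrite sumr_ge0.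
have [N0|N_gt0] := posnP N.
  rewrite big1 => [|i _]; last by have := ltn_ord i; rewrite [X in (_ < X)%N]N0.
  exact: le_trans W0 VK.
have q1 : q <= 1 := le_trans (qp (Ordinal N_gt0)) (weight_le1 _).
have t0 : 0 < t.
  apply: lt_le_trans t_ge; rewrite /burn_in ltr_wpDr// ?divr_ge0// ?(ltW q_gt0)//.
  by rewrite divr_gt0 ?mulr_gt0 ?exprn_gt0.
pose G := 2 * L0 ^+ 2 * Q + 2 / mu ^+ 2 * (\sum_(i < N) V i * p i * (m%:R * M2)).
have G_le : G <= 2 * L0 ^+ 2 * (m%:R ^+ 2 * M4) + 2 / mu ^+ 2 * (W * (m%:R * M2)).
  apply: lerD; first by rewrite ler_wpM2l// mulr_ge0 ?ltW.
  rewrite ler_wpM2l ?divr_ge0 ?(ltW mu2)// -mulr_suml.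
  rewrite ler_wpM2r ?mulr_ge0 ?(ltW M2_gt0)//.
  by apply: ler_sum => i _; rewrite ler_piMr// weight_le1.
have sum_le : \sum_(i < N) V' i <=
    N%:R * ((1 + q^-1) * (L0 ^+ 2 * alpha ^+ 2 * G)) +
    (1 + q) * (L0 ^+ 2 * mu ^+ 2 * (m%:R * M2) + (1 - q) * W).
  apply: le_trans; first by apply: ler_sum => i _; exact: step.
  rewrite big_split/= sumr_const card_ord -[X in X + _ <= _]mulr_natl -/G.
  rewrite lerD2l -mulr_sumr.
  rewrite ler_wpM2l ?addr_ge0 ?(ltW q_gt0)// big_split/= -mulr_suml p_sum mul1r.
  rewrite lerD2l mulr_sumr; apply: ler_sum => i _.
  by rewrite ler_wpM2r// lerB.
apply: le_trans sum_le _.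
(* Uses [N%:R * q <= 1] and [q <= 1], so the number of agents disappears from the constants. *)
have Nq : N%:R * (1 + q^-1) <= 2 / q ^+ 2.
  rewrite ler_pdivlMr ?exprn_gt0//.
  have -> : N%:R * (1 + q^-1) * q ^+ 2 = (N%:R * q) * (q + 1).
    by field; exact: lt0r_neq0.
  apply: le_trans (_ : 1 * (q + 1) <= 2); last by rewrite mul1r; lra.
  by rewrite ler_wpM2r ?card_mul_min_le1// addr_ge0 ?ltW.
have a2 : L0 ^+ 2 * alpha ^+ 2 = q * mu ^+ 2 / (4 * m%:R * t).
  by rewrite -stepsize mulfK// lt0r_neq0// !mulr_gt0.
have A0 : 0 <= L0 ^+ 2 * alpha ^+ 2 by rewrite mulr_ge0 ?sqr_ge0.
have G0 : 0 <= 2 * L0 ^+ 2 * (m%:R ^+ 2 * M4) + 2 / mu ^+ 2 * (W * (m%:R * M2)).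
  apply: addr_ge0; first by rewrite !mulr_ge0// ?ltW.
  by rewrite mulr_ge0 ?divr_ge0 ?(ltW mu2)// !mulr_ge0// ltW.
have first_le : N%:R * ((1 + q^-1) * (L0 ^+ 2 * alpha ^+ 2 * G)) <=
    M2 / (q * t) * W + M4 / (q * t) * noise.
  rewrite mulrA; apply: (@le_trans _ _ (2 / q ^+ 2 * (L0 ^+ 2 * alpha ^+ 2 *
    (2 * L0 ^+ 2 * (m%:R ^+ 2 * M4) + 2 / mu ^+ 2 * (W * (m%:R * M2)))))).
    apply: le_trans (_ : N%:R * (1 + q^-1) * (L0 ^+ 2 * alpha ^+ 2 *
      (2 * L0 ^+ 2 * (m%:R ^+ 2 * M4) + 2 / mu ^+ 2 * (W * (m%:R * M2)))) <= _).
      rewrite ler_wpM2l ?mulr_ge0 ?addr_ge0 ?invr_ge0 ?(ltW q_gt0)//.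
      by rewrite ler_wpM2l.
    by rewrite ler_wpM2r// mulr_ge0.
  rewrite a2 le_eqVlt; apply/orP; left; apply/eqP; rewrite /noise.
  by field; rewrite !lt0r_neq0.
have qt : 0 < q * t by rewrite mulr_gt0.
have q3 : 0 < q ^+ 3 by rewrite exprn_gt0.
have burn1 : M2 / (q * t) <= q ^+ 2 / 2.
  rewrite ler_pdivrMr//.
  have : 2 * M2 / q ^+ 3 <= t.
    by apply: le_trans t_ge; rewrite lerDl divr_ge0// ltW.
  rewrite ler_pdivrMr// => h.
  rewrite (_ : q ^+ 2 / 2 * (q * t) = t * q ^+ 3 / 2); last by ring.
  by move: h; lra.
have burn2 : M4 / (q * t) <= 1.
  rewrite ler_pdivrMr// mul1r.
  have : M4 / q <= t.
    apply: le_trans t_ge; rewrite lerDr divr_ge0 ?(ltW q3)// mulr_ge0 ?ltW//.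
  by rewrite ler_pdivrMr// mulrC.
have noise_ge0 : 0 <= noise.
  by apply: mulr_ge0 => //; apply: mulr_ge0; exact: sqr_ge0.
have b1 := ler_wpM2r W0 burn1; have b2 := ler_wpM2r noise_ge0 burn2.
have final :
    (1 - q ^+ 2 / 2) * W + (1 + 2 * M2) * noise <= stale_constant M2 * noise.
  have q2 : q ^+ 2 <= 1 by rewrite expr_le1// ltW.
  have h : (1 - q ^+ 2 / 2) * W <= (1 - q ^+ 2 / 2) * (stale_constant M2 * noise).
    by rewrite ler_wpM2l//; lra.
  have e2 : q ^+ 2 / 2 * (stale_constant M2 * noise) = (1 + 2 * M2) * noise.
    by rewrite /stale_constant; field; exact: lt0r_neq0.
  by move: h; rewrite !mulrBl e2 !mul1r; lra.
apply: le_trans final.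
have -> : (1 + q) * (L0 ^+ 2 * mu ^+ 2 * (m%:R * M2) + (1 - q) * W) =
    (1 + q) * M2 * noise + (1 - q ^+ 2) * W by rewrite /noise; ring.
have : (1 + q) * M2 * noise <= 2 * M2 * noise.
  by rewrite ler_wpM2r// ler_wpM2r ?(ltW M2_gt0)//; lra.
by move: first_le b1 b2; lra.
Qed.

End recursion.

(** * The convergence rate *)

Section convergence.
Context {d : measure_display} {Omega : measurableType d} {R : realType}.
Context {N m T : nat} {P : probability Omega R} {p : 'I_N -> R}.
Context {s : nat -> Omega -> 'I_N} {u : nat -> Omega -> 'M[R]_(N, m)}.
Context {v : 'I_N -> Omega -> 'M[R]_(N, m)} {tau : Omega -> 'I_T}.
Hypothesis model : sampling_model P p s u v tau.
Variables (f : 'M[R]_(N, m) -> R) (L0 L alpha mu : R) (x0 : 'M[R]_(N, m)).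
Variable x : nat -> Omega -> 'M[R]_(N, m).
Hypothesis run : forall w, residual_feedback_run f alpha mu x0
  (s ^~ w) (u ^~ w) (v ^~ w) (x ^~ w).
Hypothesis fL0 : elipschitz L0 f.
Hypothesis fL : esmooth L f.
Hypotheses (L_gt0 : 0 < L) (L0_gt0 : 0 < L0).
Hypotheses (alpha_ge0 : 0 <= alpha) (mu_gt0 : 0 < mu).
Variables (M2 M4 : R).
Hypotheses (M2_gt0 : 0 < M2) (M4_ge0 : 0 <= M4).
Hypothesis moments : forall X : Omega -> R, normal_law P X ->
  [/\ has_expectation P X 0, has_expectation P (fun w => X w ^+ 2) M2 &
      has_expectation P (fun w => X w ^+ 4) M4].
Variables (q t : R).
Hypotheses (q_gt0 : 0 < q) (qp : forall i, q <= p i).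
Hypothesis p_sum : \sum_(i < N) p i = 1.
Hypothesis m_gt0 : (0 < m)%N.
Hypothesis t_ge : burn_in q M2 M4 <= t.
Hypothesis stepsize : L0 ^+ 2 * alpha ^+ 2 * (4 * m%:R * t) = q * mu ^+ 2.

Let e := stale_error (s := s) (u := u) (v := v) f mu x0 x.
Let D := gradient_sqr f x.

Lemma stale_error_init i : exists2 V,
  has_expectation P (fun w => e 0 i w ^+ 2) V &
  V <= L0 ^+ 2 * mu ^+ 2 * (m%:R * M2).
Proof.
have v2 j : has_expectation P (fun w => v i w i j ^+ 2) M2.
  by have [] := moments (init_normal model i j).
have h2 := has_expectationZ (L0 ^+ 2 * mu ^+ 2)
  (has_expectation_sum (index_enum 'I_m) v2).
have ub w : e 0 i w ^+ 2 <=
    L0 ^+ 2 * mu ^+ 2 * \sum_(j < m) v i w i j ^+ 2.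
  have vE : enorm (v i w) ^+ 2 = \sum_(j < m) v i w i j ^+ 2.
    apply: (@enorm_block R N m (v i w) i (fun j => v i w i j)) => i' j.
    by rewrite (initE model) eq_sym mxE.
  rewrite -vE -!exprMn -(real_normK (num_real (e 0 i w))).
  rewrite ler_pXn2r ?nnegrE ?normr_ge0 ?mulr_ge0 ?enorm_ge0 ?(ltW L0_gt0)
    ?(ltW mu_gt0)//.
  rewrite /e /stale_error /= (proj1 (run w)); apply: le_trans (fL0 _ _) _.
  by rewrite opprD addrA subrr add0r -scaleNr enormZ normrN gtr0_norm// mulrA.
have [|w|V hV] := has_expectation_dominated (P := P)
    (X := fun w => e 0 i w ^+ 2) _ h2.
- apply: measurable_funX; apply: (measurable_generatedW model (D := past 0)).
  exact: (stale_error_measurable model run fL0).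
- by rewrite ger0_norm ?sqr_ge0.
exists V => //; apply: le_trans (has_expectation_le hV h2 ub) _.
by rewrite sumr_const card_ord mulr_natl.
Qed.

Let noise := L0 ^+ 2 * mu ^+ 2 * m%:R.
(** Loss per step in the descent: the smoothing error of the finite difference plus the second-order
    term of the step. *)
Let bias := alpha * L ^+ 2 * mu ^+ 2 / 2 * (m%:R ^+ 2 * M4) +
  L * alpha ^+ 2 * (L0 ^+ 2 * m%:R ^+ 2 * estimate_constant q M2 M4).

(** The statements are proved together: the descent bound needs the stale errors under control, and
    both need integrability at the preceding step. *)
Lemma run_invariant k :
  [/\ forall i, has_expectation P (fun w => e k i w ^+ 2)
                  (mean P (fun w => e k i w ^+ 2)),
      \sum_(i < N) mean P (fun w => e k i w ^+ 2) <=
        stale_constant q M2 * noise,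
      has_expectation P (fun w => f (x k w)) (mean P (fun w => f (x k w))) &
      mean P (fun w => f (x k w)) <=
        f x0 - \sum_(l < k) (alpha / 2 * (q * M2 * mean P (D l)) - bias)].
Proof.
have mm : 0 < m%:R :> R by rewrite ltr0n.
elim: k => [|k [he Vle hF Fle]].
  have hF : has_expectation P (fun w => f (x 0%N w)) (f x0).
    by apply: has_expectation_eq (has_expectation_cst P (f x0)) => // w;
      rewrite (proj1 (run w)).
  split=> [i||| ].
  - by have [V hV _] := stale_error_init i; exact: has_expectation_mean hV.
  (* Initially the sum is at most [N%:R * M2 * noise], which fits under [stale_constant] because
     [N%:R * q ^+ 2 <= 1]. *)
  - apply: (@le_trans _ _ (\sum_(i < N) L0 ^+ 2 * mu ^+ 2 * (m%:R * M2))).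
      apply: ler_sum => i _; have [V hV Vle] := stale_error_init i.
      by rewrite (has_expectation_unique (has_expectation_mean hV) hV).
    rewrite sumr_const card_ord -[X in X <= _]mulr_natl.
    have -> : N%:R * (L0 ^+ 2 * mu ^+ 2 * (m%:R * M2)) = N%:R * M2 * noise.
      by rewrite /noise; ring.
    have u0 : 0 <= noise.
      by apply: mulr_ge0 => //; apply: mulr_ge0; exact: sqr_ge0.
    rewrite ler_wpM2r// /stale_constant ler_pdivlMr ?exprn_gt0//.
    have Nq := card_mul_min_le1 qp p_sum.
    have Nq0 : 0 <= N%:R * q by rewrite mulr_ge0// ltW.
    have q1 : N%:R * q ^+ 2 <= 1.
      rewrite expr2 mulrA; case: (posnP N) => [N0|N_gt0].
        by rewrite N0 !mul0r.
      have := le_trans (qp (Ordinal N_gt0)) (weight_le1 q_gt0 qp p_sum _).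
      by nra.
    rewrite (_ : N%:R * M2 * q ^+ 2 = M2 * (N%:R * q ^+ 2)); last by ring.
    by apply: le_trans (ler_wpM2l (ltW M2_gt0) q1) _; have := M2_gt0; lra.
  - exact: has_expectation_mean hF.
  - rewrite big_ord0 subr0.
    by rewrite (has_expectation_unique (has_expectation_mean hF) hF).
have e0 i : 0 <= mean P (fun w => e k i w ^+ 2).
  apply: has_expectation_le (has_expectation_cst P 0) (he i) _ => w.
  exact: sqr_ge0.
have [Q [Q0 QM hQ]] := block_sqr2_expectation model moments k.
have QE := has_expectation_unique (has_expectation_mean hQ) hQ.
have stale i := stale_error_step model run fL0 L0_gt0 mu_gt0 moments he i q_gt0.
have hV' i : has_expectation P (fun w => e k.+1 i w ^+ 2)
    (mean P (fun w => e k.+1 i w ^+ 2)).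
  by have [V hV _] := stale i; exact: has_expectation_mean hV.
have [F hF' F'le] := objective_step model run fL0 fL L_gt0 L0_gt0 alpha_ge0 mu_gt0
  moments he hF M2_gt0 qp.
split=> //.
- apply: (stale_recursion q_gt0 qp p_sum m_gt0 M2_gt0 M4_ge0 L0_gt0 mu_gt0 t_ge
    stepsize e0 Vle (Q := Q)); first by rewrite Q0 QM.
  move=> i; have [V hV] := stale i.
  rewrite /estimate_sqr_mean QE => Vle'.
  by rewrite (has_expectation_unique (has_expectation_mean hV) hV).
- exact: has_expectation_mean hF'.
- rewrite (has_expectation_unique (has_expectation_mean hF') hF').
  apply: le_trans F'le _; rewrite big_ord_recr/= QE.
  have Gle := estimate_bound q_gt0 qp p_sum m_gt0 M2_gt0 mu_gt0 e0 Vle QM.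
  have b1 : alpha * L ^+ 2 * mu ^+ 2 / 2 * Q <=
      alpha * L ^+ 2 * mu ^+ 2 / 2 * (m%:R ^+ 2 * M4).
    apply: ler_wpM2l QM; apply: divr_ge0 => //.
    by apply: mulr_ge0; [apply: mulr_ge0 => //|]; exact: sqr_ge0.
  have b2 : L * alpha ^+ 2 * estimate_sqr_mean (P := P) (p := p) (s := s)
      (u := u) L0 mu M2 k
      (fun i => mean P (fun w => e k i w ^+ 2)) <=
    L * alpha ^+ 2 * (L0 ^+ 2 * m%:R ^+ 2 * estimate_constant q M2 M4).
    apply: ler_wpM2l; first by apply: mulr_ge0; [exact: ltW|exact: sqr_ge0].
    by rewrite /estimate_sqr_mean QE.
  rewrite /bias; move: Fle b1 b2; rewrite /bias; lra.
Qed.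

Lemma average_gradient_bound fstar : (forall y, fstar <= f y) ->
  alpha / 2 * (q * M2) * \sum_(l < T) mean P (D l) <= f x0 - fstar + T%:R * bias.
Proof.
move=> f_ge; have [_ _ hF Fle] := run_invariant T.
have := has_expectation_le (has_expectation_cst P fstar) hF (fun w => f_ge _).
move: Fle; rewrite sumrB sumr_const card_ord -[bias *+ _]mulr_natl.
have -> : \sum_(l < T) alpha / 2 * (q * M2 * mean P (D l)) =
    alpha / 2 * (q * M2) * \sum_(l < T) mean P (D l).
  by rewrite mulr_sumr; apply: eq_bigr => l _; ring.
lra.
Qed.

End convergence.

Lemma p_min_le (R : realType) (N : nat) (p : 'I_N -> R) i : p_min p <= p i.
Proof. exact: bigmin_le. Qed.

Lemma p_min_gt0 (R : realType) (N : nat) (p : 'I_N -> R) :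
  (forall i, 0 < p i) -> 0 < p_min p.
Proof. by move=> p0; apply: lt_bigmin => // i _. Qed.

(** * Arithmetic of the prescribed step size and smoothing parameter *)

Section rate.
Context {R : realType}.
Variables (q M2 M4 L0 L Delta a : R) (m : nat).
Hypotheses (q_gt0 : 0 < q) (q_le1 : q <= 1) (M2_gt0 : 0 < M2) (M4_ge0 : 0 <= M4).
Hypotheses (L0_gt0 : 0 < L0) (L_gt0 : 0 < L) (Delta_ge0 : 0 <= Delta).
Hypotheses (a_ge1 : 1 <= a) (m_gt0 : (0 < m)%N).

(** With [a] in the role of the sixth root of the number of iterations, all exponents become
    integers. *)
Let alpha := Num.sqrt q / a ^+ 4.
Let mu := 2 * L0 * Num.sqrt m%:R / a.
Let c1 := estimate_constant q M2 M4.

Let a_gt0 : 0 < a. Proof. exact: lt_le_trans a_ge1. Qed.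
Let sq_gt0 : 0 < Num.sqrt q. Proof. by rewrite sqrtr_gt0. Qed.
Let m_ge1 : 1 <= m%:R :> R. Proof. by rewrite ler1n. Qed.

Definition rate_constant : R :=
  2 / (q * M2) * (Delta / Num.sqrt q + 2 * L ^+ 2 * L0 ^+ 2 * M4
                  + L * L0 ^+ 2 * c1).

Lemma estimate_constant_ge0 : 0 <= c1.
Proof.
rewrite /c1 /estimate_constant /stale_constant.
have q2 : 0 < q ^+ 2 by rewrite exprn_gt0.
apply: addr_ge0; first exact: mulr_ge0.
apply: mulr_ge0; first by rewrite mulr_ge0 ?ltW.
rewrite divr_ge0 ?(ltW q2)//; apply: mulr_ge0 => //; have := M2_gt0; lra.
Qed.

Lemma rate_constant_ge0 : 0 <= rate_constant.
Proof.
apply: mulr_ge0; first by rewrite divr_ge0 ?mulr_ge0 ?ltW.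
apply: addr_ge0; last first.
  apply: mulr_ge0 estimate_constant_ge0; apply: mulr_ge0; first exact: ltW.
  exact: sqr_ge0.
apply: addr_ge0; first by rewrite divr_ge0// ltW.
apply: mulr_ge0 => //; apply: mulr_ge0; last exact: sqr_ge0.
by apply: mulr_ge0 => //; exact: sqr_ge0.
Qed.

Lemma balanced_stepsize :
  L0 ^+ 2 * alpha ^+ 2 * (4 * m%:R * a ^+ 6) = q * mu ^+ 2.
Proof.
rewrite /alpha /mu !expr_div_n !exprMn !sqr_sqrtr ?(ltW q_gt0) ?ler0n//.
by field; exact: lt0r_neq0.
Qed.

(** Division by the coefficient of [S] leaves the initial gap of order [a ^- 2], the smoothing error
    of order [m ^ 3 * a ^- 2] and the second-order term of order [m ^ 2 * alpha]. The cube comes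
    from the factor [m] in [mu ^+ 2]. *)
Lemma rate_bound S :
  alpha / 2 * (q * M2) * S <= Delta + a ^+ 6 *
    (alpha * L ^+ 2 * mu ^+ 2 / 2 * (m%:R ^+ 2 * M4) +
     L * alpha ^+ 2 * (L0 ^+ 2 * m%:R ^+ 2 * c1)) ->
  (a ^+ 6)^-1 * S <= rate_constant * m%:R ^+ 3 * (a ^+ 2)^-1.
Proof.
have alpha_gt0 : 0 < alpha by rewrite divr_gt0// exprn_gt0.
have mu2 : mu ^+ 2 = 4 * L0 ^+ 2 * m%:R / a ^+ 2.
  by rewrite /mu expr_div_n !exprMn sqr_sqrtr ?ler0n//; field; exact: lt0r_neq0.
have c1_ge0 := estimate_constant_ge0.
have den : 0 < alpha / 2 * (q * M2) by rewrite mulr_gt0 ?divr_gt0 ?mulr_gt0.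
have a6 : 0 < a ^+ 6 by rewrite exprn_gt0.
have a2 : 0 < a ^+ 2 by rewrite exprn_gt0.
rewrite -ler_pdivlMl// => S_le.
have a6V : 0 <= (a ^+ 6)^-1 by rewrite invr_ge0 ltW.
apply: le_trans (ler_wpM2l a6V S_le) _.
have -> : (a ^+ 6)^-1 * ((alpha / 2 * (q * M2))^-1 * (Delta + a ^+ 6 *
    (alpha * L ^+ 2 * mu ^+ 2 / 2 * (m%:R ^+ 2 * M4) +
     L * alpha ^+ 2 * (L0 ^+ 2 * m%:R ^+ 2 * c1)))) =
  2 / (q * M2) * (Delta / Num.sqrt q * (a ^+ 2)^-1 +
     2 * L ^+ 2 * L0 ^+ 2 * M4 * (m%:R ^+ 3 * (a ^+ 2)^-1) +
     L * L0 ^+ 2 * c1 * (m%:R ^+ 2 * alpha)).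
  rewrite mu2 /alpha; field.
  by rewrite !lt0r_neq0.
have w0 : 0 < (a ^+ 2)^-1 by rewrite invr_gt0.
have w1 : (a ^+ 2)^-1 <= 1 by rewrite invf_le1// exprn_ege1.
have sq1 : Num.sqrt q <= 1 by rewrite -sqrtr1 ler_sqrt.
have alpha_le : alpha <= (a ^+ 2)^-1.
  have -> : alpha = Num.sqrt q * (a ^+ 2)^-1 * (a ^+ 2)^-1.
    by rewrite /alpha; field; exact: lt0r_neq0.
  by rewrite ler_piMl ?(ltW w0)// mulr_ile1 ?(ltW sq_gt0) ?(ltW w0).
have m23 : m%:R ^+ 2 <= m%:R ^+ 3 :> R by rewrite ler_weXn2l.
have m3 : 1 <= m%:R ^+ 3 :> R by rewrite exprn_ege1.
rewrite /rate_constant -[leRHS]mulrA -[leRHS]mulrA; apply: ler_wpM2l.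
  by rewrite divr_ge0 ?mulr_ge0 ?ltW.
set w := (a ^+ 2)^-1 in w0 w1 alpha_le *.
rewrite !mulrDl; apply: lerD; first apply: lerD => //.
- apply: ler_wpM2l; first by rewrite divr_ge0// ltW.
  by rewrite ler_peMl// ltW.
- apply: ler_wpM2l.
    by apply: mulr_ge0 c1_ge0; apply: mulr_ge0; [exact: ltW|exact: sqr_ge0].
  by apply: ler_pM => //; exact: ltW.
Qed.

End rate.

(** * Choice of the constant and the two regimes of the iteration count *)

Theorem theorem1 (R : realType) :
  exists C : R -> R -> R -> R -> R,
  forall (N nbar T : nat) (L0 L1 fstar : R) (f : 'M[R]_(N, nbar) -> R)
    (x0 : 'M[R]_(N, nbar)) (p : 'I_N -> R)
    (d : measure_display) (Omega : measurableType d) (P : probability Omega R)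
    (s : nat -> Omega -> 'I_N) (u : nat -> Omega -> 'M[R]_(N, nbar))
    (v : 'I_N -> Omega -> 'M[R]_(N, nbar)) (tau : Omega -> 'I_T)
    (x : nat -> Omega -> 'M[R]_(N, nbar)) (alpha mu : R),
  (0 < N)%N -> (0 < nbar)%N -> (0 < T)%N -> 0 < L0 ->
  (forall y, fstar <= f y) -> elipschitz L0 f -> esmooth L1 f ->
  (forall i, 0 < p i) -> \sum_(i < N) p i = 1 ->
  alpha = Num.sqrt (p_min p) / T%:R `^ (2 / 3) ->
  mu = 2 * L0 * Num.sqrt nbar%:R / T%:R `^ (1 / 6) ->
  sampling_model P p s u v tau ->
  (forall w, residual_feedback_run f alpha mu x0
     (s ^~ w) (u ^~ w) (v ^~ w) (x ^~ w)) ->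
  ('E_P[fun w => (enorm (gradient f (x (tau w) w)) ^+ 2)%R] <=
   (C L0 L1 (p_min p) (f x0 - fstar) * nbar%:R ^+ 3
      * T%:R `^ (- (1 / 3)))%:E)%E.
Proof.
have [M2 [M4 [M2_gt0 M4_ge0 mom]]] := normal_moments R.
(* The first summand serves the iteration counts below [burn_in], the second the larger ones;
   [|L1| + 1] is a positive smoothness constant whatever the sign of [L1]. *)
exists (fun L0 L1 q Delta => L0 ^+ 2 / q * burn_in q M2 M4 +
  rate_constant q M2 M4 L0 (`|L1| + 1) Delta).
move=> N nbar T L0 L1 fstar f x0 p d Omega P s u v tau x alpha mu N_gt0 m_gt0
  T_gt0 L0_gt0 f_ge fL0 fL1 p_gt0 p_sum alphaE muE model run.
set q := p_min p; set L := `|L1| + 1; set Delta := f x0 - fstar.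
have q_gt0 : 0 < q by exact: p_min_gt0.
have qp i : q <= p i by exact: p_min_le.
have q_le1 : q <= 1.
  by apply: le_trans (qp (Ordinal N_gt0)) _; exact: weight_le1 q_gt0 qp p_sum _.
have L_gt0 : 0 < L by rewrite ltr_wpDl.
have fL : esmooth L f.
  split; first by case: fL1.
  move=> y z; apply: le_trans (proj2 fL1 y z) _.
  by apply: ler_wpM2r; [exact: enorm_ge0|rewrite (le_trans (ler_norm _))// lerDl].
have Delta_ge0 : 0 <= Delta by rewrite subr_ge0.
have T_ge1 : 1 <= T%:R :> R by rewrite ler1n.
pose a : R := T%:R `^ (1 / 6).
have aX n : T%:R `^ (n%:R / 6) = a ^+ n.
  by rewrite -powR_mulrn ?powR_ge0// -powRrM; congr (_ `^ _); field.
have a6 : a ^+ 6 = T%:R by rewrite -aX divff ?pnatr_eq0// powRr1.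
have a_ge1 : 1 <= a by rewrite -[leLHS](powRr0 T%:R); apply: ler_powR.
have alpha_a : alpha = Num.sqrt q / a ^+ 4.
  by rewrite alphaE -aX; congr (_ / _ `^ _); field.
have mu_a : mu = 2 * L0 * Num.sqrt nbar%:R / a by [].
have rate_a : T%:R `^ (- (1 / 3)) = (a ^+ 2)^-1 :> R.
  by rewrite powRN -aX; congr (_ `^ _)^-1; field.
have a_gt0 : 0 < a := lt_le_trans ltr01 a_ge1.
have mm : 0 < nbar%:R :> R by rewrite ltr0n.
have alpha_ge0 : 0 <= alpha by rewrite alpha_a divr_ge0 ?sqrtr_ge0 ?exprn_ge0// ltW.
have mu_gt0 : 0 < mu by rewrite muE divr_gt0// !mulr_gt0// sqrtr_gt0.
have htau : has_expectation P (fun w => gradient_sqr f x (tau w) w)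
    (T%:R^-1 * \sum_(t < T) mean P (gradient_sqr f x t)).
  (* All candidate iterates have index below [T], so they are determined by the past of step [T]. *)
  apply: (has_expectation_output model (k := T)
    (X := fun t : 'I_T => gradient_sqr f x t)) => t.
    apply: (generated_sub (D := past t)); last first.
      exact: (gradient_sqr_measurable model run fL0 fL).
    move=> [[[l|l]|i]|//] //= lt; exact: ltn_trans lt (ltn_ord t).
  exact: (gradient_sqr_expectation model run fL0 fL t).
have -> : 'E_P[fun w => (enorm (gradient f (x (tau w) w)) ^+ 2)%R]%E =
    (T%:R^-1 * \sum_(t < T) mean P (gradient_sqr f x t))%:E.
  by rewrite unlock; exact: htau.2.
rewrite lee_fin rate_a.
have a2 : 0 < (a ^+ 2)^-1 by rewrite invr_gt0 exprn_gt0.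
have m3 : 1 <= nbar%:R ^+ 3 :> R by rewrite exprn_ege1// ler1n.
have rate_ge0 := rate_constant_ge0 L0 q_gt0 M2_gt0 M4_ge0 L_gt0 Delta_ge0.
have burn_ge0 : 0 <= burn_in q M2 M4.
  rewrite addr_ge0 ?divr_ge0 ?(ltW q_gt0)//; last by rewrite exprn_ge0 ?ltW.
  by rewrite mulr_ge0 ?ltW.
have L0q : 0 <= L0 ^+ 2 / q by rewrite divr_ge0 ?sqr_ge0 ?ltW.
(* For small [T] the bound by the Lipschitz constant suffices: [a ^+ 2 <= a ^+ 6 = T < burn_in] lets
   the factor [burn_in] compensate the decay [(a ^+ 2)^-1]. *)
have [Tsmall|Tlarge] := ltP (T%:R : R) (burn_in q M2 M4).
  have trivial_bound := has_expectation_le htau (has_expectation_cst P _)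
    (fun w => gradient_sqr_le x fL0 fL L0_gt0 (tau w) w).
  apply: le_trans trivial_bound _; rewrite natrM.
  have Nq := card_mul_min_le1 qp p_sum.
  apply: (@le_trans _ _ (L0 ^+ 2 / q * nbar%:R)).
    have -> : N%:R * nbar%:R * L0 ^+ 2 = N%:R * q * (L0 ^+ 2 / q * nbar%:R).
      by field; exact: lt0r_neq0.
    apply: ler_piMl Nq; exact: mulr_ge0.
  apply: (@le_trans _ _ (L0 ^+ 2 / q * burn_in q M2 M4 * nbar%:R ^+ 3 *
    (a ^+ 2)^-1)); last first.
    rewrite !mulrDl lerDl; apply: mulr_ge0; last exact: ltW.
    by apply: mulr_ge0 => //; exact: le_trans ler01 m3.
  rewrite -[leRHS]mulrA -[leRHS]mulrA; apply: ler_wpM2l => //.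
  have m13 : nbar%:R <= nbar%:R ^+ 3 :> R by rewrite ler_eXnr// ler1n.
  apply: le_trans m13 _; rewrite mulrCA ler_peMr ?exprn_ge0//.
  rewrite ler_pdivlMr ?exprn_gt0// mul1r; apply: le_trans (ltW Tsmall).
  by rewrite -a6 ler_weXn2l.
have stepsize : L0 ^+ 2 * alpha ^+ 2 * (4 * nbar%:R * T%:R) = q * mu ^+ 2.
  by rewrite -a6 alpha_a mu_a; exact: balanced_stepsize q_gt0 a_ge1.
have := average_gradient_bound model run fL0 fL L_gt0 L0_gt0 alpha_ge0 mu_gt0
  M2_gt0 M4_ge0 (mom _ _ P) q_gt0 qp p_sum m_gt0 Tlarge stepsize f_ge.
rewrite -a6 alpha_a mu_a => /(rate_bound q_gt0 q_le1 M2_gt0 M4_ge0 L_gt0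
  Delta_ge0 a_ge1 m_gt0) /le_trans; apply.
rewrite !mulrDl lerDr; apply: mulr_ge0; last exact: ltW.
apply: mulr_ge0; last exact: le_trans ler01 m3.
exact: mulr_ge0.
Qed.
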